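(* Let $\varphi$ be a $G_2$-structure with associated metric $g$ on a smooth $7$-dimensional manifold $M$. Then, given nowhere-vanishing octonion sections $U,V\in\Gamma(\mathbb{O}M)$, $$\sigma_U\left(\sigma_V\varphi\right)=\sigma_{UV}(\varphi),$$ where $UV$ is the octonion product with respect to $\varphi$.
   Context: Setting. A $G_2$-structure on a smooth $7$-manifold $M$ is identified with a positive $3$-form $\varphi$, i.e. one that at each point lies in the $GL(7,\mathbb{R})$-orbit of $\varphi_0=e^{123}+e^{145}+e^{167}+e^{246}-e^{257}-e^{347}-e^{356}$. It determines a unique Riemannian metric $g$ and volume form $\mathrm{vol}$ (hence an orientation) by $g(u,v)\,\mathrm{vol}=\frac16(u\lrcorner\varphi)\wedge(v\lrcorner\varphi)\wedge\varphi$, where $\lrcorner$ is contraction. Let $*$ be the Hodge star. Octonion bundle. $\mathbb{O}M=\Lambda^0\oplus TM$, where $\Lambda^0$ is the trivial real line bundle; an octonion section is $A=(a,\alpha)$ with $a$ a function and $\alpha$ a vector field. Inner product: $\langle (a,\alpha),(b,\beta)\rangle=ab+g(\alpha,\beta)$. Cross product: $\langle\alpha\times\beta,\gamma\rangle=\varphi(\alpha,\beta,\gamma)$. Octonion product with respect to $\varphi$: $AB=(ab-\langle\alpha,\beta\rangle,\ a\beta+b\alpha+\alpha\times\beta)$. For a nowhere-vanishing octonion section $A=(a,\alpha)$ and a $G_2$-structure $\varphi$ with metric $g$, define $$\sigma_A(\varphi)=\frac{1}{|A|^2}\left((a^2-|\alpha|^2)\varphi-2a\,\alpha\lrcorner(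 *\varphi)+2\alpha\wedge(\alpha\lrcorner\varphi)\right),$$ where in the wedge product $\alpha$ denotes the dual $1$-form via $g$. It is known that $\sigma_A(\varphi)$ is again a positive $3$-form with the same associated metric and orientation as $\varphi$; so $\sigma_U(\sigma_V\varphi)$ is given by the same formula with $\varphi$ replaced by $\sigma_V\varphi$ and the same $g$ and $*$. *)

(* Defs.v *)
From HB Require Import structures.
From mathcomp Require Import all_boot all_order all_algebra all_fingroup.
From mathcomp Require Import all_classical all_reals all_analysis.

Set Implicit Arguments.
Unset Strict Implicit.
Unset Printing Implicit Defensive.

Import Order.TTheory GRing.Theory Num.Theory.
Import numFieldNormedType.Exports.

Local Open Scope classical_set_scope.
Local Open Scope ring_scope.

(** * Exterior algebra of R^n

A k-tuple of vectors of R^n is the k x n matrix whose rows are the vectors, so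
a k-form is a function on 'M_(k, n).  The type [kform] only records this shape
(and its pointwise R-module structure); [is_form] adds multilinearity and
alternation. *)

Notation kform R k n := ('M[R]_(k, n) -> R^o) (only parsing).

Definition is_form (R : realType) (k n : nat) (w : kform R k n) : Prop :=
  (forall (i : 'I_k) (A B C : 'M[R]_(k, n)) (b c : R),
     row i A = b *: row i B + c *: row i C ->
     (forall j, j != i -> row j B = row j A /\ row j C = row j A) ->
     w A = b * w B + c * w C) /\
  (forall (i j : 'I_k) (A : 'M[R]_(k, n)),
     i != j -> row i A = row j A -> w A = 0).

Definition contract (R : realType) (k n : nat)
    (u : 'rV[R]_n) (w : kform R (1 + k) n) : kform R k n :=
  fun W => w (col_mx u W).

Lemma is_form_contract (R : realType) (k n : nat) (u : 'rV[R]_n)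
    (w : kform R (1 + k) n) : is_form w -> is_form (contract u w).
Proof.
move=> [wlin walt]; split=> [i A B C b c Ai BC|i j A ij Aij].
  apply: (wlin (rshift 1 i)) => [|j]; first by rewrite !rowKd.
  case: (split_ordP j) => j' ->; first by rewrite !rowKu.
  by rewrite !rowKd (inj_eq (@rshift_inj _ _)); exact: BC.
by apply: (walt (rshift 1 i) (rshift 1 j)); rewrite ?(inj_eq (@rshift_inj _ _)) ?rowKd.
Qed.

(* Normalized so that (e^1 /\ e^2)(e_1, e_2) = 1. *)
Definition wedge (R : realType) (k l n : nat)
    (w : kform R k n) (h : kform R l n) : kform R (k + l) n :=
  fun W => (k`!%:R * l`!%:R)^-1 *
    \sum_(s : 'S_(k + l))
      (-1) ^+ s * w (usubmx (row_perm s W)) * h (dsubmx (row_perm s W)).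

(** ** Inner products, given by their Gram matrix in the standard basis *)

Definition inner (R : realType) (n : nat) (G : 'M[R]_n) (u v : 'rV[R]_n) : R :=
  (u *m G *m v^T) 0 0.

Definition inner_product (R : realType) (n : nat) (G : 'M[R]_n) : Prop :=
  (forall u v, inner G u v = inner G v u) /\
  (forall u, u != 0 -> 0 < inner G u u).

Definition flat (R : realType) (n : nat) (G : 'M[R]_n) (u : 'rV[R]_n) :
    kform R 1 n :=
  fun v => inner G u v.

Definition sharp (R : realType) (n : nat) (G : 'M[R]_n) (w : kform R 1 n) :
    'rV[R]_n :=
  (\row_i w (delta_mx 0 i)) *m invmx G.

Definition volume_form (R : realType) (n : nat)
    (G : 'M[R]_n) (vol : kform R n n) : Prop :=
  is_form vol /\
  (forall E : 'M[R]_n, E *m G *m E^T = 1%:M -> `|vol E| = 1).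

(* The index formula
     ( *w )_{j_1..j_l} = 1/k! w^{i_1..i_k} vol_{i_1..i_k j_1..j_l}:
   row i of [invmx G] is the vector obtained by raising the index of e^i, and
   the rows of [rowsub f 1%:M] are e_{f 0}, ..., e_{f (k-1)}.  It is the
   convention h /\ *w = <h, w> vol. *)
Definition hodge (R : realType) (k l : nat)
    (G : 'M[R]_(k + l)) (vol : kform R (k + l) (k + l))
    (w : kform R k (k + l)) : kform R l (k + l) :=
  fun W => k`!%:R^-1 *
    \sum_(f : {ffun 'I_k -> 'I_(k + l)})
      w (rowsub f (invmx G)) * vol (col_mx (rowsub f 1%:M) W).

(** * Positive 3-forms and octonions on R^7 *)

(* Indices start at 1, as in e^1, ..., e^7. *)
Definition coform (R : realType) (i : nat) : kform R 1 7 :=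
  fun v => v 0 (inord i.-1).

Definition coform3 (R : realType) (i j k : nat) : kform R 3 7 :=
  wedge (wedge (coform i) (coform j)) (coform k).

Definition phi0 (R : realType) : kform R 3 7 :=
  coform3 1 2 3 + coform3 1 4 5 + coform3 1 6 7 + coform3 2 4 6
  - coform3 2 5 7 - coform3 3 4 7 - coform3 3 5 6.

Definition positive_form (R : realType) (w : kform R 3 7) : Prop :=
  exists2 P : 'M[R]_7, P \in unitmx & w = (fun W => phi0 (W *m P)).

(* g(u,v) vol = 1/6 (u _| w) /\ (v _| w) /\ w, with vol the volume form of g *)
Definition induces (R : realType) (w : kform R 3 7)
    (G : 'M[R]_7) (vol : kform R 7 7) : Prop :=
  [/\ inner_product G, volume_form G vol &
    forall u v : 'rV[R]_7,
      inner G u v *: vol =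
      6^-1 *: (wedge (wedge (@contract R 2 7 u w) (@contract R 2 7 v w)) w
                : kform R 7 7)].

Definition cross (R : realType) (G : 'M[R]_7) (w : kform R 3 7)
    (u v : 'rV[R]_7) : 'rV[R]_7 :=
  sharp G (@contract R 1 7 v (@contract R 2 7 u w)).

Lemma inner_product_unit (R : realType) (n : nat) (G : 'M[R]_n) :
  inner_product G -> G \in unitmx.
Proof.
case=> _ Gpos; rewrite -row_free_unit; apply/row_freeP.
apply/row_freeP/inj_row_free => u uG0; apply/eqP; apply: contraT => /Gpos.
by rewrite /inner uG0 mul0mx mxE ltxx.
Qed.

Lemma sharpP (R : realType) (n : nat) (G : 'M[R]_n) (w : kform R 1 n)
    (z : 'rV[R]_n) :
  inner_product G -> is_form w -> inner G (sharp G w) z = w z.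
Proof.
move=> Gip [wlin _]; have Gu := inner_product_unit Gip.
have wD (b c : R) (x y : 'rV[R]_n) : w (b *: x + c *: y) = b * w x + c * w y.
  by apply: (wlin 0) => [|j]; rewrite ?linearD ?linearZ // !ord1 eqxx.
rewrite /inner /sharp mulmxKV // mxE {2}(row_sum_delta z).
elim/big_rec2: _ => [|i x _ _ ->].
  by have := wD 0 0 0 0; rewrite !scale0r !addr0 !mul0r addr0.
by rewrite -{2}[x]scale1r wD mul1r !mxE mulrC.
Qed.

Lemma crossP (R : realType) (G : 'M[R]_7) (w : kform R 3 7) (u v z : 'rV[R]_7) :
  inner_product G -> is_form w ->
  inner G (cross G w u v) z = w (col_mx u (col_mx v z)).
Proof. by move=> Gip wf; rewrite /cross sharpP //; do 2 apply: is_form_contract. Qed.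

Definition octonion (R : realType) : Type := (R * 'rV[R]_7)%type.

Definition onorm2 (R : realType) (G : 'M[R]_7) (A : octonion R) : R :=
  A.1 ^+ 2 + inner G A.2 A.2.

Definition omul (R : realType) (G : 'M[R]_7) (w : kform R 3 7)
    (A B : octonion R) : octonion R :=
  (A.1 * B.1 - inner G A.2 B.2,
   A.1 *: B.2 + B.1 *: A.2 + cross G w A.2 B.2).

Definition sigma_at (R : realType) (G : 'M[R]_7) (vol : kform R 7 7)
    (A : octonion R) (w : kform R 3 7) : kform R 3 7 :=
  let: (a, u) := A in
  (onorm2 G A)^-1 *:
    ((a ^+ 2 - inner G u u) *: w
     - (2 * a) *: @contract R 3 7 u (@hodge R 3 4 G vol w)
     + 2 *: (wedge (flat G u) (@contract R 2 7 u w) : kform R 3 7)).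

(** * Smooth manifolds *)

Definition partials (R : realType) (n : nat) (s : seq 'I_n)
    (f : 'rV[R]_n -> R^o) : 'rV[R]_n -> R^o :=
  foldr (fun i h => 'D_(delta_mx 0 i) h) f s.

(* C^oo on an open set D: all iterated partial derivatives exist and are
   continuous. *)
Definition smooth_on (R : realType) (n : nat) (D : set 'rV[R]_n)
    (f : 'rV[R]_n -> R^o) : Prop :=
  forall (s : seq 'I_n) (x : 'rV[R]_n), D x ->
    (forall i, derivable (partials s f) x (delta_mx 0 i)) /\
    {for x, continuous (partials s f)}.

Record chart (R : realType) (n : nat) (M : topologicalType) := Chart {
  chart_fun :> M -> 'rV[R]_n ;
  chart_inv : 'rV[R]_n -> M ;
  chart_dom : set M ;
  chart_dom_open : open chart_dom ;
  chart_img_open : open (chart_fun @` chart_dom) ;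
  chart_funK : forall p, chart_dom p -> chart_inv (chart_fun p) = p ;
  chart_fun_cont : forall p, chart_dom p -> {for p, continuous chart_fun} ;
  chart_inv_cont : forall y, (chart_fun @` chart_dom) y ->
    {for y, continuous chart_inv}
}.

Definition chart_img (R : realType) (n : nat) (M : topologicalType)
    (c : chart R n M) : set 'rV[R]_n :=
  c @` chart_dom c.

(* The atlas comes with a preferred chart around each point: it identifies
   every tangent space T_p M with R^n. *)
Record smooth_manifold (R : realType) (n : nat) := SmoothManifold {
  carrier :> topologicalType ;
  manifold_hausdorff : hausdorff_space carrier ;
  manifold_second_countable : @second_countable carrier ;
  atlas : set (chart R n carrier) ;
  atlas_compat : forall c d, atlas c -> atlas d -> forall j,
    smooth_on (c @` (chart_dom c `&` chart_dom d))
      (fun y => d (chart_inv c y) 0 j) ;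
  chart_at : carrier -> chart R n carrier ;
  chart_at_atlas : forall p, atlas (chart_at p) ;
  chart_at_dom : forall p, chart_dom (chart_at p) p
}.

(* The matrix taking the coordinates (v *m _) of a tangent vector at p in the
   chart c to its coordinates in the chart d; its rows are the coordinate
   vector fields of c at p expressed in d. *)
Definition transition (R : realType) (n : nat) (M : topologicalType)
    (c d : chart R n M) (p : M) : 'M[R]_n :=
  jacobian (d \o chart_inv c) (c p).

(** ** Sections: functions whose value at p is expressed in [chart_at p] *)

Definition smooth_fun (R : realType) (n : nat) (M : smooth_manifold R n)
    (f : M -> R) : Prop :=
  forall c : chart R n M, atlas c ->
    smooth_on (chart_img c) (fun y => f (chart_inv c y)).

Definition smooth_vector_field (R : realType) (n : nat)
    (M : smooth_manifold R n) (X : M -> 'rV[R]_n) : Prop :=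
  forall c : chart R n M, atlas c -> forall j,
    smooth_on (chart_img c)
      (fun y => let p := chart_inv c y in
         (X p *m transition (chart_at p) c p) 0 j).

Definition differential_form (R : realType) (n k : nat)
    (M : smooth_manifold R n) (w : M -> kform R k n) : Prop :=
  (forall p, is_form (w p)) /\
  (forall c : chart R n M, atlas c -> forall f : 'I_k -> 'I_n,
    smooth_on (chart_img c)
      (fun y => let p := chart_inv c y in
         w p (rowsub f (transition c (chart_at p) p)))).

Definition riemannian_metric (R : realType) (n : nat)
    (M : smooth_manifold R n) (g : M -> 'M[R]_n) : Prop :=
  (forall p, inner_product (g p)) /\
  (forall c : chart R n M, atlas c -> forall i j,
    smooth_on (chart_img c)
      (fun y => let p := chart_inv c y in
         inner (g p) (row i (transition c (chart_at p) p))
                     (row j (transition c (chart_at p) p)))).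

(** * G2-structures and octonion sections *)

Definition G2_structure (R : realType) (M : smooth_manifold R 7)
    (phi : M -> kform R 3 7) : Prop :=
  differential_form phi /\ forall p, positive_form (phi p).

Definition associated_metric (R : realType) (M : smooth_manifold R 7)
    (phi : M -> kform R 3 7) (g : M -> 'M[R]_7) (vol : M -> kform R 7 7) : Prop :=
  [/\ riemannian_metric g, differential_form vol &
      forall p, induces (phi p) (g p) (vol p)].

Definition octonion_section (R : realType) (M : smooth_manifold R 7)
    (A : M -> octonion R) : Prop :=
  smooth_fun (fun p => (A p).1) /\ smooth_vector_field (fun p => (A p).2).

Definition nowhere_vanishing (R : realType) (M : smooth_manifold R 7)
    (A : M -> octonion R) : Prop :=
  forall p, A p <> (0, 0).

Definition octonion_mul (R : realType) (M : smooth_manifold R 7)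
    (g : M -> 'M[R]_7) (phi : M -> kform R 3 7) (A B : M -> octonion R) :
    M -> octonion R :=
  fun p => omul (g p) (phi p) (A p) (B p).

Definition sigma (R : realType) (M : smooth_manifold R 7)
    (g : M -> 'M[R]_7) (vol : M -> kform R 7 7)
    (A : M -> octonion R) (phi : M -> kform R 3 7) : M -> kform R 3 7 :=
  fun p => sigma_at (g p) (vol p) (A p) (phi p).

(* Main.v *)
(* Everything is pointwise.  If phi = phi0 (_ P), the identity defining the
   metric forces G = P P^T and vol = det (_ P), so the rows of P^-1 form an
   oriented orthonormal frame.  Measured on this frame, sigma becomes an explicit
   polynomial formula in a, u and the components of the 3-form, and the two
   identities sigma_U (sigma_V phi) = sigma_UV phi and |UV| = |U| |V| become
   polynomial identities with integer coefficients in 16 variables, which are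
   decided by normalization. *)
From Stdlib Require Ring_polynom.
From mathcomp Require Import all_boot all_order all_algebra all_fingroup.
From mathcomp Require Import all_classical all_reals all_analysis.
From mathcomp Require Import zify ring lra.
Require Import Defs.

Set Implicit Arguments.
Unset Strict Implicit.
Unset Printing Implicit Defensive.

Import Order.TTheory GRing.Theory Num.Theory.

Local Open Scope ring_scope.

(** * Alternating forms *)

Section Forms.
Variables (R : realType) (n : nat).
Implicit Types (k l : nat).

(** Two obstacles shape the proof. The first is the denominators: [sigma] divides by a squared norm,
    so only its numerator is polynomial. That numerator is linear in the 3-form, so the inner factor
    1/|V|^2 comes out, and the claim splits into an identity between numerators and the
    multiplicativity of the octonion norm. The second is computation: forms are functions on real
    matrices, and their sums over permutations or index functions do not reduce. Each object
    therefore gets a computable double proved to agree with it. Sums of coordinate forms become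
    lists of integers with index lists, and coefficient formulas are read in polynomials over [int].
    The Hodge star needs most care: its definition uses the coordinate basis and G^-1, so it is
    moved to the orthonormal frame and then cut from 343 index triples to the 35 increasing ones.
    The frame is adapted to phi and serves unchanged for sigma_V phi, because the same [G] and [vol]
    are used there; only the coefficients of the 3-form change. *)

Lemma form_slot_sum k (w : kform R (1 + k) n) (I : Type) (s : seq I)
    (c : I -> R) (v : I -> 'rV[R]_n) (W : 'M[R]_(k, n)) :
  is_form w ->
  w (col_mx (\sum_(j <- s) c j *: v j) W) =
  \sum_(j <- s) c j * w (col_mx (v j) W).
Proof.
move=> [wlin _].
have wD b d x y :
    w (col_mx (b *: x + d *: y) W) = b * w (col_mx x W) + d * w (col_mx y W).
  apply: (wlin (lshift k 0)) => [|j]; first by rewrite !rowKu !row_id.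
  by case: (split_ordP j) => j' ->; rewrite ?rowKd // ord1 eqxx.
elim/big_rec2: _ => [|i y x _ IH].
  by have := wD 0 0 0 0; rewrite !scale0r !addr0 !mul0r addr0.
by rewrite -[x]scale1r wD IH mul1r.
Qed.

Lemma big_ffun_ordS (T : nmodType) (I : finType) k
    (F : {ffun 'I_(1 + k) -> I} -> T) :
  \sum_f F f =
  \sum_j \sum_(f : {ffun 'I_k -> I})
     F [ffun i => match fintype.split i with inl _ => j | inr i' => f i' end].
Proof.
rewrite pair_big /=.
rewrite (reindex (fun p : I * {ffun 'I_k -> I} =>
  [ffun i => match fintype.split i with inl _ => p.1 | inr i' => p.2 i' end])) //=.
exists (fun f : {ffun 'I_(1 + k) -> I} =>
          (f (lshift k 0), [ffun i => f (rshift 1 i)])) => [[j f] _|f _] /=.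
  rewrite ffunE (unsplitK (inl _)); congr pair.
  by apply/ffunP => i; rewrite !ffunE (unsplitK (inr _)).
apply/ffunP => i; rewrite ffunE.
by case: (split_ordP i) => i' ->; rewrite ?ffunE // ord1.
Qed.

Lemma big_ffun_ord0 (T : nmodType) (I : finType)
    (F : {ffun 'I_0 -> I} -> T) f0 : \sum_f F f = F f0.
Proof.
rewrite (big_pred1 f0) // => f; apply/esym/eqP/ffunP; by case.
Qed.

(** The rows of [X *m B] are combinations of the rows of [B]; multilinearity is applied slot by
    slot, peeling off the first argument with [contract]. With [B] a frame, this reduces a form to
    its values on frame vectors. *)
Lemma form_expand k m (w : kform R k n) (X : 'M[R]_(k, m)) (B : 'M[R]_(m, n)) :
  is_form w ->
  w (X *m B) =
  \sum_(f : {ffun 'I_k -> 'I_m}) (\prod_i X i (f i)) * w (rowsub f B).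
Proof.
elim: k => [|k IH] in w X *.
  move=> _; pose f0 : {ffun 'I_0 -> 'I_m} := ffun0 (card_ord 0).
  by rewrite (big_ffun_ord0 _ f0) big_ord0 mul1r; congr w; apply/matrixP; case.
rewrite -[k.+1]/(1 + k)%N in w X * => wf.
rewrite -[X]vsubmxK mul_col_mx {1}[usubmx X *m B]mulmx_sum_row form_slot_sum //.
rewrite big_ffun_ordS; apply: eq_bigr => j _.
rewrite -[LHS]/(_ * contract (row j B) w _) IH; last exact: is_form_contract.
rewrite mulr_sumr; apply: eq_bigr => f _; rewrite mulrA; congr (_ * _).
  rewrite big_split_ord big_ord1 /= vsubmxK; congr (_ * _).
    by rewrite !mxE ffunE (unsplitK (inl _)).
  by apply: eq_bigr => i _; rewrite !mxE ffunE (unsplitK (inr _)).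
congr w; apply/matrixP => i i'; rewrite !mxE ffunE.
by case: fintype.split => // i0; rewrite !mxE.
Qed.

Lemma formDE k (w h : kform R k n) A : (w + h) A = w A + h A :> R.
Proof. by []. Qed.

Lemma formZE k a (w : kform R k n) A : (a *: w) A = a * w A :> R.
Proof. by []. Qed.

Lemma form_sumE k (I : Type) (s : seq I) (w : I -> kform R k n) A :
  (\sum_(i <- s) w i) A = \sum_(i <- s) w i A :> R.
Proof. by elim/big_ind2: _ => // x f y h <- <-. Qed.

Lemma is_formD k (w h : kform R k n) :
  is_form w -> is_form h -> is_form (w + h).
Proof.
move=> [wl wa] [hl ha]; split=> [i A B C b c Ai BC|i j A ij Aij].
  by rewrite !formDE (wl _ _ _ _ _ _ Ai BC) (hl _ _ _ _ _ _ Ai BC); ring.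
by rewrite formDE (wa i j) // (ha i j) // addr0.
Qed.

Lemma is_formZ k (a : R) (w : kform R k n) : is_form w -> is_form (a *: w).
Proof.
move=> [wl wa]; split=> [i A B C b c Ai BC|i j A ij Aij].
  by rewrite !formZE (wl _ _ _ _ _ _ Ai BC); ring.
by rewrite formZE (wa i j) // mulr0.
Qed.

Lemma is_form0 k : is_form (0 : kform R k n).
Proof.
split=> [i A B C b c _ _|//].
by rewrite -[LHS]/(0 : R) -[(0 : kform R k n) B]/(0 : R)
  -[(0 : kform R k n) C]/(0 : R) !mulr0 addr0.
Qed.

Lemma is_form_sum k (I : Type) (s : seq I) (w : I -> kform R k n) :
  (forall i, is_form (w i)) -> is_form (\sum_(i <- s) w i).
Proof.
move=> wf; elim/big_rec: _ => [|i h _]; first exact: is_form0.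
exact: is_formD.
Qed.

Lemma is_form_col_mxr k l (w : kform R (k + l) n) (A : 'M[R]_(k, n)) :
  is_form w -> is_form ((fun W => w (col_mx A W)) : kform R l n).
Proof.
move=> [wl wa]; split=> [i B C D b c Bi CD|i j B ij Bij].
  apply: (wl (rshift k i)) => [|j]; first by rewrite !rowKd.
  case: (split_ordP j) => j' ->; first by rewrite !rowKu.
  by rewrite !rowKd (inj_eq (@rshift_inj _ _)); exact: CD.
by apply: (wa (rshift k i) (rshift k j)); rewrite ?(inj_eq (@rshift_inj _ _)) ?rowKd.
Qed.

Lemma is_form_col_mxl k l (w : kform R (k + l) n) (A : 'M[R]_(l, n)) :
  is_form w -> is_form ((fun W => w (col_mx W A)) : kform R k n).
Proof.
move=> [wl wa]; split=> [i B C D b c Bi CD|i j B ij Bij].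
  apply: (wl (lshift l i)) => [|j]; first by rewrite !rowKu.
  case: (split_ordP j) => j' ->; last by rewrite !rowKd.
  by rewrite !rowKu (inj_eq (@lshift_inj _ _)); exact: CD.
by apply: (wa (lshift l i) (lshift l j)); rewrite ?(inj_eq (@lshift_inj _ _)) ?rowKu.
Qed.

(** Linearity holds permutation by permutation: row [i] of the argument reaches exactly one factor,
    decided by the position s^-1 i. For alternation, s -> s * [tperm i j] flips the sign and keeps
    both factors, since rows i and j agree; the sum equals its opposite. *)
Lemma is_form_wedge k l (w : kform R k n) (h : kform R l n) :
  is_form w -> is_form h -> is_form (wedge w h).
Proof.
move=> [wl _] [hl _]; rewrite /wedge; split=> [i A B C b c Ai BC|i j A ij Aij].
  rewrite !(mulrCA _ (_^-1)) -mulrDr; congr (_ * _).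
  rewrite !mulr_sumr -big_split; apply: eq_bigr => s _ /=.
  have rowu (D : 'M[R]_(k + l, n)) r :
      row r (usubmx (row_perm s D)) = row (s (lshift l r)) D.
    by apply/rowP => x; rewrite !mxE.
  have rowd (D : 'M[R]_(k + l, n)) r :
      row r (dsubmx (row_perm s D)) = row (s (rshift k r)) D.
    by apply/rowP => x; rewrite !mxE.
  case: (split_ordP (s^-1%g i)) => i' /(canRL (permK _)); rewrite invgK => iE.
    have dE D : (forall j, j != i -> row j D = row j A) ->
        dsubmx (row_perm s D) = dsubmx (row_perm s A).
      move=> DA; apply/row_matrixP => r; rewrite !rowd DA //.
      by rewrite iE (inj_eq perm_inj) eq_rlshift.
    rewrite (dE B) ?(dE C) => [|j /BC[]//|j /BC[]//].
    rewrite (wl i' _ (usubmx (row_perm s B)) (usubmx (row_perm s C)) b c).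
    - set X := w _; set Y := w _; set Z := h _.
      by move: ((-1) ^+ s) X Y Z => e X Y Z; ring.
    - by rewrite !rowu -iE.
    move=> j ji; rewrite !rowu; apply: BC.
    by rewrite iE (inj_eq perm_inj) (inj_eq (@lshift_inj _ _)).
  have uE D : (forall j, j != i -> row j D = row j A) ->
      usubmx (row_perm s D) = usubmx (row_perm s A).
    move=> DA; apply/row_matrixP => r; rewrite !rowu DA //.
    by rewrite iE (inj_eq perm_inj) eq_lrshift.
  rewrite (uE B) ?(uE C) => [|j /BC[]//|j /BC[]//].
  rewrite (hl i' _ (dsubmx (row_perm s B)) (dsubmx (row_perm s C)) b c).
  - set X := w _; set Y := h _; set Z := h _.
    by move: ((-1) ^+ s) X Y Z => e X Y Z; ring.
  - by rewrite !rowd -iE.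
  move=> j ji; rewrite !rowd; apply: BC.
  by rewrite iE (inj_eq perm_inj) (inj_eq (@rshift_inj _ _)).
set F := fun s : 'S_(k + l) =>
  w (usubmx (row_perm s A)) * h (dsubmx (row_perm s A)).
have FE s : F (s * tperm i j)%g = F s.
  suff E : row_perm (s * tperm i j)%g A = row_perm s A by rewrite /F E.
  apply/row_matrixP => r; apply/rowP => x; rewrite !mxE permM.
  have /rowP/(_ x) := Aij; rewrite !mxE => Ax.
  by case: tpermP => // ->.
under eq_bigr => s _ do rewrite -mulrA -/(F s).
suff -> : \sum_(s : 'S_(k + l)) (-1) ^+ s * F s = 0 by rewrite mulr0.
set S := \sum_s _; suff : S = - S by lra.
rewrite {1}/S (reindex_inj (mulIg (tperm i j))) -sumrN.
apply: eq_bigr => s _ /=; rewrite FE odd_permM odd_tperm ij addbT.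
by rewrite signrN mulNr.
Qed.

Lemma is_form_flat (G : 'M[R]_n) (u : 'rV[R]_n) : is_form (flat G u).
Proof.
split=> [i A B C b c|i j]; last by rewrite !ord1 eqxx.
rewrite !row_id => -> _.
by rewrite /flat /inner linearD !linearZ /= mulmxDr -!scalemxAr !mxE.
Qed.

(** Polarization: with [row i A + row j A] in both slots the form vanishes, and only the two mixed
    terms survive the expansion, so they are opposite. *)
Lemma form_xrow k (w : kform R k n) (i j : 'I_k) (A : 'M[R]_(k, n)) :
  is_form w -> i != j -> w (xrow i j A) = - w A.
Proof.
move=> [wl wa] ij.
pose M x y : 'M[R]_(k, n) :=
  \matrix_r (if r == i then x else if r == j then y else row r A).
have Mi x y : row i (M x y) = x by rewrite rowK eqxx.
have Mj x y : row j (M x y) = y by rewrite rowK eqxx eq_sym (negPf ij).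
have MD x x' y : w (M (x + x') y) = w (M x y) + w (M x' y).
  rewrite -[RHS]/(w (M x y) + w (M x' y) : R) -[w (M x y)]mul1r -[w (M x' y)]mul1r.
  apply: (wl i); first by rewrite !Mi !scale1r.
  by move=> r ri; rewrite !rowK (negPf ri).
have MDr x y y' : w (M x (y + y')) = w (M x y) + w (M x y').
  rewrite -[w (M x y)]mul1r -[w (M x y')]mul1r.
  apply: (wl j); first by rewrite !Mj !scale1r.
  by move=> r rj; rewrite !rowK (negPf rj).
have M0 x : w (M x x) = 0 by apply: (wa i j) => //; rewrite Mi Mj.
have /eqP := M0 (row i A + row j A).
rewrite MD !MDr !M0 add0r addr0 addr_eq0 => /eqP E.
have -> : xrow i j A = M (row j A) (row i A).
  apply/row_matrixP => r; rewrite rowK; apply/rowP => x; rewrite !mxE.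
  case: tpermP => [->|->|/eqP/negPf-> /eqP/negPf->]; last by rewrite mxE.
    by rewrite eqxx mxE.
  by rewrite eqxx eq_sym (negPf ij) mxE.
suff AE : A = M (row i A) (row j A) by rewrite [in RHS]AE E opprK.
apply/row_matrixP => r; rewrite rowK.
by case: eqP => [->//|_]; case: eqP => [->|].
Qed.

End Forms.

(** * Permutation sums and the wedge with a 1-form *)

Lemma form_row_perm (R : realType) n k (w : kform R k n) (s : 'S_k)
    (A : 'M[R]_(k, n)) :
  is_form w -> w (row_perm s A) = (-1) ^+ s * w A.
Proof.
move=> wf; case: (prod_tpermP s) => ts -> {s}.
elim: ts => [|t ts IH] /= tsP; first by rewrite big_nil row_perm1 odd_perm1 mul1r.
case/andP: tsP => t12 /IH{}IH; rewrite big_cons row_permM.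
by rewrite [LHS]form_xrow // IH odd_mul_tperm t12 signr_addb expr1 mulN1r mulNr.
Qed.

Lemma big_lift_perm (T : nmodType) n (F : 'S_n.+1 -> T) :
  \sum_s F s = \sum_i \sum_(s : 'S_n) F (lift_perm ord0 i s).
Proof.
rewrite (partition_big (fun s : 'S_n.+1 => s ord0) xpredT) //=.
apply: eq_bigr => i _; rewrite (reindex (lift_perm ord0 i)).
  by apply: eq_bigl => s; rewrite lift_perm_id eqxx.
pose g (s : 'S_n.+1) (k : 'I_n) := odflt k (unlift i (s (lift ord0 k))).
have gE (s : 'S_n.+1) : s ord0 = i -> forall k, lift i (g s k) = s (lift ord0 k).
  move=> si k; rewrite /g; case: unliftP => //= E.
  have /eqP := etrans E (esym si).
  by rewrite (inj_eq perm_inj) eq_sym (negPf (neq_lift _ _)).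
(* The correspondence makes sense only for s 0 = i; any other s is replaced by a dummy permutation
   with that property, so that [perm] yields a total inverse. *)
have gI (s : 'S_n.+1) : injective (g (if s ord0 == i then s else lift_perm ord0 i 1)).
  set s' := if _ then _ else _.
  have si : s' ord0 = i by rewrite /s'; case: eqP => // _; rewrite lift_perm_id.
  move=> k l /(congr1 (lift i)); rewrite !gE // => /perm_inj; exact: lift_inj.
exists (fun s => perm (gI s)) => [s _|s /eqP si].
  apply/permP => k; apply: (@lift_inj _ i).
  by rewrite permE lift_perm_id eqxx gE ?lift_perm_id // lift_perm_lift.
apply/permP => k; case: (unliftP ord0 k) => [l|] ->; last by rewrite lift_perm_id.
by rewrite lift_perm_lift permE si eqxx gE.
Qed.

(** Permutations are grouped by the row i given to [f]. Within a group the l! orderings of the other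
    rows contribute equally, because [h] is alternating, and this cancels the normalization. *)
Lemma wedge1E (R : realType) n l (f : kform R 1 n) (h : kform R l n)
    (W : 'M[R]_(1 + l, n)) :
  is_form h ->
  wedge f h W = \sum_(i < 1 + l) (-1) ^+ i * f (row i W) * h (row' i W).
Proof.
move=> hf; rewrite /wedge -[(1`!)%N]/1%N mul1r big_lift_perm mulr_sumr.
apply: eq_bigr => i _.
have l0 : (l`!)%:R != 0 :> R by rewrite pnatr_eq0 -lt0n fact_gt0.
apply: (mulfI l0); rewrite mulVKf // mulr_natl -[in RHS]card_Sn -sumr_const.
apply: eq_bigr => s _.
have -> : @usubmx R 1 l n (row_perm (lift_perm ord0 i s) W) = row i W.
  apply/matrixP => a b; rewrite !mxE; congr (W _ _).
  by rewrite (_ : lshift l a = ord0) ?lift_perm_id //; apply/val_inj; rewrite /= ord1.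
have -> : @dsubmx R 1 l n (row_perm (lift_perm ord0 i s) W) = row_perm s (row' i W).
  apply/matrixP => a b; rewrite !mxE; congr (W _ _).
  by rewrite (_ : rshift 1 a = lift ord0 a) ?lift_perm_lift //; apply/val_inj.
rewrite form_row_perm // odd_lift_perm /=.
rewrite signr_addb signr_odd.
have: (-1) ^+ s * (-1) ^+ s = 1 :> R by rewrite -signr_addb addbb.
move: ((-1) ^+ s) ((-1) ^+ i) => e d ee.
by rewrite mulrACA -(mulrA d e e) ee mulr1 mulrA.
Qed.

Lemma wedge12E (R : realType) n (f : kform R 1 n) (h : kform R 2 n)
    (x y z : 'rV[R]_n) :
  is_form h ->
  wedge f h (col_mx x (col_mx y z)) =
  f x * h (col_mx y z) - f y * h (col_mx x z) + f z * h (col_mx x y).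
Proof.
move=> hf; set W : 'M[R]_(3, n) := col_mx x _.
transitivity (\sum_(i < 3) (-1) ^+ i * f (row i W) * h (row' i W)).
  exact: wedge1E.
have W0 a : W 0 a = x 0 a.
  transitivity (W (@lshift 1 2 0) a); last exact: col_mxEu.
  by congr (W _ _); apply/val_inj.
have W1 a : W 1 a = y 0 a.
  transitivity (W (@rshift 1 2 (@lshift 1 1 0)) a).
    by congr (W _ _); apply/val_inj.
  by rewrite [LHS](@col_mxEd _ 1 2) [LHS](@col_mxEu _ 1 1).
have W2 a : W 2 a = z 0 a.
  transitivity (W (@rshift 1 2 (@rshift 1 1 0)) a).
    by congr (W _ _); apply/val_inj.
  by rewrite [LHS](@col_mxEd _ 1 2) [LHS](@col_mxEd _ 1 1).
have rE (p : 'rV[R]_n) (i : 'I_3) : (forall a, W i a = p 0 a) -> row i W = p.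
  by move=> Wp; apply/rowP => a; rewrite mxE Wp.
have r'E (p q : 'rV[R]_n) (i : 'I_3) : (forall a, W (lift i 0) a = p 0 a) ->
    (forall a, W (lift i 1) a = q 0 a) -> row' i W = col_mx p q.
  move=> Wp Wq; apply/matrixP => b a; rewrite mxE.
  case: (@split_ordP 1 1 b) => c ->;
    rewrite [c]ord1 [RHS](@col_mxEu _ 1 1, @col_mxEd _ 1 1).
    by rewrite -Wp; congr (W (lift _ _) _); apply/val_inj.
  by rewrite -Wq; congr (W (lift _ _) _); apply/val_inj.
have l1 : lift ord0 ord0 = 1 :> 'I_3 by apply/val_inj.
have l2 : lift ord0 (lift ord0 ord0) = 2 :> 'I_3 by apply/val_inj.
rewrite !big_ord_recl big_ord0 addr0 l1 l2 /=.
rewrite (rE x) // (rE y) // (rE z) //.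
rewrite (r'E y z) => [|a|a]; first last.
- by rewrite -W2; congr (W _ _); apply/val_inj.
- by rewrite -W1; congr (W _ _); apply/val_inj.
rewrite (r'E x z) => [|a|a]; first last.
- by rewrite -W2; congr (W _ _); apply/val_inj.
- by rewrite -W0; congr (W _ _); apply/val_inj.
rewrite (r'E x y) => [|a|a]; first last.
- by rewrite -W1; congr (W _ _); apply/val_inj.
- by rewrite -W0; congr (W _ _); apply/val_inj.
rewrite -[(1 %% 3)%N]/1%N -[((1 + 1) %% 3)%N]/2%N expr0 expr1.
by rewrite sqrrN expr1n !mul1r mulN1r mulNr addrA.
Qed.

(** * Wedge products of minors *)

(** The coordinate form e^{f 0} /\ ... /\ e^{f (k-1)}, written as a determinant; [wedge_minor]
    justifies this reading. *)
Definition minor (R : realType) n k (f : 'I_k -> 'I_n) : kform R k n :=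
  fun W => \det (colsub f W).
Arguments minor R {n k} f.

Lemma sum_perm_signE (R : realType) n (M : 'M[R]_n) (t : 'S_n) :
  \sum_(s : 'S_n) (-1) ^+ s * ((-1) ^+ t * \prod_i M (s i) (t i)) = \det M.
Proof.
transitivity ((-1) ^+ t * \det (col_perm t M)^T).
  rewrite mulr_sumr; apply: eq_bigr => s _; rewrite mulrCA; congr (_ * (_ * _)).
  by apply: eq_bigr => i _; rewrite !mxE.
by rewrite det_tr col_permE det_mulmx det_perm mulrCA odd_permV -signr_addb addbb mulr1.
Qed.

(** The sign of the juxtaposed permutation is read off its permutation matrix, which is block
    diagonal; [rat] only hosts these determinants. *)
Lemma split_perm_ex k l (t1 : 'S_k) (t2 : 'S_l) :
  exists2 t : 'S_(k + l),
    (forall i, t (lshift l i) = lshift l (t1 i)) /\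
    (forall i, t (rshift k i) = rshift k (t2 i)) &
    t = t1 (+) t2 :> bool.
Proof.
pose g i := match fintype.split i with
  | inl j => lshift l (t1 j) | inr j => rshift k (t2 j) end.
have gl i : g (lshift l i) = lshift l (t1 i) by rewrite /g (unsplitK (inl _)).
have gr i : g (rshift k i) = rshift k (t2 i) by rewrite /g (unsplitK (inr _)).
have gI : injective g.
  move=> i j; case: (split_ordP i) => i' ->; case: (split_ordP j) => j' ->.
  - by rewrite !gl => /lshift_inj/perm_inj ->.
  - by rewrite gl gr => /eqP; rewrite eq_lrshift.
  - by rewrite gl gr => /eqP; rewrite eq_rlshift.
  - by rewrite !gr => /rshift_inj/perm_inj ->.
exists (perm gI); first by split=> i; rewrite permE.
apply: (@signr_inj rat); rewrite signr_addb -!det_perm.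
rewrite -(det_ublock _ 0).
congr (\det _); apply/matrixP => i j; rewrite !mxE permE.
case: (split_ordP i) => i' ->; case: (split_ordP j) => j' ->;
  rewrite ?gl ?gr !mxE ?(unsplitK (inl _)) ?(unsplitK (inr _)) !mxE.
- by rewrite (inj_eq (@lshift_inj _ _)).
- by rewrite eq_lrshift.
- by rewrite eq_rlshift.
- by rewrite (inj_eq (@rshift_inj _ _)).
Qed.

Lemma sum_split_perm_signE (R : realType) k l (M : 'M[R]_(k + l))
    (t1 : 'S_k) (t2 : 'S_l) :
  \sum_(s : 'S_(k + l)) (-1) ^+ s * ((-1) ^+ t1 * (-1) ^+ t2 *
     ((\prod_i M (s (lshift l i)) (lshift l (t1 i))) *
      (\prod_i M (s (rshift k i)) (rshift k (t2 i))))) = \det M.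
Proof.
have [t [tl tr] tE] := split_perm_ex t1 t2.
rewrite -(sum_perm_signE _ t); apply: eq_bigr => s _.
rewrite tE signr_addb big_split_ord /=; congr (_ * (_ * (_ * _))).
  by apply: eq_bigr => i _; rewrite tl.
by apply: eq_bigr => i _; rewrite tr.
Qed.

(** Both factors are expanded by the Leibniz formula over t1 and t2. For each fixed pair, the sum
    over s is already the whole determinant with its columns reordered, so k! l! equal copies appear
    and cancel the normalization. *)
Lemma wedge_minor (R : realType) n k l (f : 'I_(k + l) -> 'I_n) :
  wedge (minor R (f \o @lshift k l)) (minor R (f \o @rshift k l)) = minor R f.
Proof.
apply/funext => W; rewrite /wedge /minor.
have F0 m : (m`!)%:R != 0 :> R by rewrite pnatr_eq0 -lt0n fact_gt0.
apply: (mulfI (mulf_neq0 (F0 k) (F0 l))); rewrite mulVKf ?mulf_neq0 //.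
transitivity (\sum_(t1 : 'S_k) \sum_(t2 : 'S_l) \det (colsub f W)); last first.
  by rewrite !sumr_const !card_Sn -mulrnA -[LHS]mulr_natl mulnC natrM.
under [RHS]eq_bigr => t1 _ do
  (under eq_bigr => t2 _ do rewrite -(sum_split_perm_signE _ t1 t2)).
under [RHS]eq_bigr => t1 _ do rewrite exchange_big.
rewrite [RHS]exchange_big; apply: eq_bigr => s _ /=.
rewrite -!mulrA {1}/determinant mulr_suml mulr_sumr; apply: eq_bigr => t1 _.
rewrite {1}/determinant mulr_sumr mulr_sumr; apply: eq_bigr => t2 _.
rewrite mulrACA -!mulrA; congr (_ * (_ * (_ * (_ * _)))).
  by apply: eq_bigr => i _; rewrite !mxE.
by apply: eq_bigr => i _; rewrite !mxE.
Qed.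

Definition del (j : nat) (s : seq nat) : seq nat := take j s ++ drop j.+1 s.

Lemma nth_del (j : nat) s i :
  (j < size s)%N -> nth 0%N (del j s) i = nth 0%N s (bump j i).
Proof.
move=> js; rewrite nth_cat size_take js /bump [(j <= i)%N]leqNgt; case: ltnP => ij /=.
  by rewrite nth_take.
by rewrite nth_drop; congr nth; lia.
Qed.

(* The Laplace expansion, along the first row, of the determinant of the matrix
   with rows e_(s_0), e_(s_1), ... *)
Fixpoint levi (n : nat) (s : seq nat) : int :=
  if n is m.+1 then
    if s is x :: r then
      if x \in r then 0 else (-1) ^+ x * levi m (map (unbump x) r)
    else 0
  else 1.

(** If the leading index recurs, two rows coincide. Otherwise the first row has its only 1 in column
    x, and [unbump x] renumbers the columns left in the cofactor. Volumes of basis vectors thus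
    become integers found by computation. *)
Lemma det_levi (R : comRingType) n (s : seq nat) :
  size s = n -> all (gtn n) s ->
  \det (\matrix_(i < n, j < n) (nth 0%N s i == j)%N%:R) = (levi n s)%:~R :> R.
Proof.
elim: n s => [|n IH] [|x r] //=; first by rewrite det_mx00.
case=> rn /andP[xn rlt]; case: ifP => xr.
  pose i : 'I_n.+1 := inord (index x r).+1.
  have iE : val i = (index x r).+1 by rewrite /i /= inordK // ltnS -rn index_mem.
  apply: (@determinant_alternate _ _ _ ord0 i); first by rewrite -val_eqE /= iE.
  by move=> j; rewrite !mxE iE /= nth_index.
rewrite (expand_det_row _ ord0) (bigD1 (Ordinal xn)) //= big1 ?addr0; last first.
  by move=> j; rewrite -val_eqE /= mxE /= eq_sym => /negPf ->; rewrite mul0r.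
rewrite mxE eqxx mul1r /cofactor rmorphM rmorphXn rmorphN1; congr (_ * _).
rewrite -[RHS]/((levi n _)%:~R) -IH ?size_map //; last first.
  apply/allP => y /mapP[z zr ->]; have := allP rlt z zr.
  have : z != x by apply: contraFneq xr => <-.
  by rewrite /unbump /=; case: ltnP; lia.
congr (\det _); apply/matrixP => i j; rewrite !mxE /=.
have ir : (i < size r)%N by rewrite rn.
rewrite (nth_map 0%N) //; congr (nat_of_bool _)%:R.
have yx : nth 0%N r i != x by apply: contraFneq xr => <-; exact: mem_nth.
by rewrite add0n -{1}(@unbumpK x (nth 0%N r i)) // (inj_eq (can_inj (bumpK x))).
Qed.

Section WedgeSum.
Variables (R : realType) (n : nat).

Lemma wedge_suml k l (I : Type) (r : seq I) (c : I -> R)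
    (w : I -> kform R k n) (h : kform R l n) :
  wedge (\sum_(i <- r) c i *: w i) h =
  \sum_(i <- r) c i *: (wedge (w i) h : kform R (k + l) n).
Proof.
apply/funext => W; rewrite [RHS]form_sumE [LHS]/wedge.
transitivity ((k`!%:R * l`!%:R)^-1 * \sum_(t : 'S_(k + l)) \sum_(i <- r)
    c i * ((-1) ^+ t * w i (usubmx (row_perm t W)) * h (dsubmx (row_perm t W)))).
  congr (_ * _); apply: eq_bigr => t _.
  rewrite form_sumE mulr_sumr mulr_suml; apply: eq_bigr => i _.
  by rewrite formZE mulrCA -!mulrA.
rewrite exchange_big mulr_sumr; apply: eq_bigr => i _.
by rewrite formZE -mulr_sumr mulrCA.
Qed.

Lemma wedge_sumr k l (J : Type) (s : seq J) (d : J -> R)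
    (w : kform R k n) (h : J -> kform R l n) :
  wedge w (\sum_(j <- s) d j *: h j) =
  \sum_(j <- s) d j *: (wedge w (h j) : kform R (k + l) n).
Proof.
apply/funext => W; rewrite [RHS]form_sumE [LHS]/wedge.
transitivity ((k`!%:R * l`!%:R)^-1 * \sum_(t : 'S_(k + l)) \sum_(j <- s)
    d j * ((-1) ^+ t * w (usubmx (row_perm t W)) * h j (dsubmx (row_perm t W)))).
  congr (_ * _); apply: eq_bigr => t _.
  rewrite form_sumE mulr_sumr; apply: eq_bigr => i _.
  by rewrite formZE mulrCA.
rewrite exchange_big mulr_sumr; apply: eq_bigr => i _.
by rewrite formZE -mulr_sumr mulrCA.
Qed.

End WedgeSum.

(** * Integer combinations of coordinate forms, encoded as lists *)

Section ListForms.
Variables (R : realType) (n : nat).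

(** [nth] and [inord] supply defaults, so a list stands for the intended form when it has size [k]
    and entries at most [n]; these conditions reappear below as boolean side conditions. The ambient
    dimension is n.+1, as [inord] requires. *)
Definition lminor k (s : seq nat) : kform R k n.+1 :=
  minor R (fun i : 'I_k => inord (nth 0%N s i)).
Arguments lminor : clear implicits.

Definition lform k (L : seq (int * seq nat)) : kform R k n.+1 :=
  \sum_(x <- L) (x.1%:~R : R) *: lminor k x.2.
Arguments lform : clear implicits.

Lemma wedge_lminor k l s1 s2 : size s1 = k ->
  wedge (lminor k s1) (lminor l s2) = lminor (k + l) (s1 ++ s2).
Proof.
move=> s1k; apply: etrans (wedge_minor _ _); rewrite /lminor.
congr wedge; congr minor; apply/funext => i /=.
  by rewrite nth_cat s1k ltn_ord.
by rewrite nth_cat s1k ltnNge leq_addr /= addKn.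
Qed.

Definition lwedge (L1 L2 : seq (int * seq nat)) : seq (int * seq nat) :=
  [seq (x.1 * y.1, x.2 ++ y.2) | x <- L1, y <- L2].

Lemma wedge_lform k l L1 L2 : all (fun x => size x.2 == k) L1 ->
  wedge (lform k L1) (lform l L2) = lform (k + l) (lwedge L1 L2).
Proof.
move=> L1k; rewrite /lform wedge_suml big_allpairs_dep /=.
apply: eq_big_seq => x xL1; rewrite wedge_sumr scaler_sumr; apply: eq_bigr => y _.
by rewrite wedge_lminor ?scalerA ?intrM //; exact/eqP/(allP L1k).
Qed.

(** Contraction by the basis vector e_i is an antiderivation: each occurrence of i, at position j,
    is removed with sign (-1)^j. *)
Definition lcontract (i : nat) (L : seq (int * seq nat)) : seq (int * seq nat) :=
  flatten [seq [seq ((-1) ^+ j * x.1, del j x.2)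
               | j <- iota 0 (size x.2) & nth 0%N x.2 j == i] | x <- L].

Lemma contract_lminor k (u : 'rV[R]_n.+1) s : size s = k.+1 ->
  @contract R k n.+1 u (lminor k.+1 s) =
  \sum_(j <- iota 0 k.+1)
     ((-1) ^+ j * u 0 (inord (nth 0%N s j))) *: lminor k (del j s).
Proof.
move=> sk; apply/funext => W; rewrite form_sumE /contract /lminor /minor.
rewrite (expand_det_row _ ord0) -/(index_iota 0 k.+1) big_mkord.
apply: eq_bigr => j _; rewrite formZE /lminor /minor /cofactor mulrCA mulrA.
congr (_ * _).
  congr (_ * _); rewrite mxE.
  transitivity (col_mx u W (@lshift 1 k 0) (inord (nth 0%N s j))).
    by congr (col_mx u W _ _); apply/val_inj.
  by rewrite col_mxEu.
apply: (congr1 (@determinant R k)); apply/matrixP => a b; rewrite !mxE.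
case: fintype.splitP => [c|c] /= ac.
  by have := ltn_ord c; rewrite -ac.
have -> : c = a by apply/val_inj; move: ac; rewrite /bump /=; lia.
congr (W _ (inord _)).
by rewrite nth_del // sk.
Qed.

Lemma contract_lform k i L : (i < n.+1)%N ->
  all (fun x => (size x.2 == k.+1) && all (gtn n.+1) x.2) L ->
  @contract R k n.+1 (delta_mx 0 (inord i)) (lform k.+1 L) = lform k (lcontract i L).
Proof.
move=> ilt Lk; rewrite /lform /lcontract big_flatten big_map.
transitivity (\sum_(x <- L) (x.1%:~R : R) *:
    (@contract R k n.+1 (delta_mx 0 (inord i)) (lminor k.+1 x.2) : kform R k n.+1)).
  by apply/funext => W; rewrite form_sumE [LHS]form_sumE.
apply: eq_big_seq => x xL; have /andP[/eqP xk /allP xn] := allP Lk _ xL.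
rewrite contract_lminor // big_map big_filter xk [RHS]big_mkcond scaler_sumr.
apply: eq_big_seq => j; rewrite mem_iota add0n => /= jk.
have jn : (nth 0%N x.2 j < n.+1)%N by apply/xn/mem_nth; rewrite xk.
rewrite mxE eqxx -val_eqE /= !inordK // eq_sym; case: eqP => _ /=.
  by rewrite mulr1 scalerA mulrC intrM rmorphXn rmorphN1.
by rewrite mulr0 scale0r scaler0.
Qed.

Lemma lform0E (L : seq (int * seq nat)) W :
  lform 0 L W = (\sum_(x <- L) x.1)%:~R.
Proof.
rewrite [LHS]form_sumE rmorph_sum; apply: eq_bigr => x _.
by rewrite formZE [lminor _ _ _]det_mx00 mulr1.
Qed.

(** A top-degree coordinate form selects columns of [W], that is, multiplies it by a matrix of basis
    columns; that matrix contributes the factor [levi]. *)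
Lemma lform_detE (L : seq (int * seq nat)) W :
  all (fun x => (size x.2 == n.+1) && all (gtn n.+1) x.2) L ->
  lform n.+1 L W = (\sum_(x <- L) x.1 * levi n.+1 x.2)%:~R * \det W.
Proof.
move=> Lk; have -> : (\sum_(x <- L) x.1 * levi n.+1 x.2)%:~R =
    \sum_(x <- L) x.1%:~R * (levi n.+1 x.2)%:~R :> R.
  by rewrite rmorph_sum; apply: eq_bigr => x _; rewrite rmorphM.
rewrite [LHS]form_sumE mulr_suml.
apply: eq_big_seq => x xL; have /andP[/eqP xk xn] := allP Lk _ xL.
rewrite formZE -mulrA; congr (_ * _); rewrite -det_levi // -det_tr mulrC -det_mulmx.
rewrite /lminor /minor; congr (\det _); apply/matrixP => a b.
have bn : (nth 0%N x.2 b < n.+1)%N by apply/(allP xn)/mem_nth; rewrite xk.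
rewrite !mxE (bigD1 (inord (nth 0%N x.2 b))) //= big1 ?addr0 => [|c cb].
  by rewrite !mxE inordK // eqxx mulr1.
rewrite !mxE; case: eqP => [E|]; last by rewrite mulr0.
by rewrite E inord_val eqxx in cb.
Qed.

End ListForms.
Arguments lminor R n k s : clear implicits.
Arguments lform R n k L : clear implicits.

(** * The metric of a positive form *)

(** Indices are shifted to start at 0: e^{123} is listed as 0, 1, 2. *)
Definition phi0_terms : seq (int * seq nat) :=
  [:: (1, [:: 0; 1; 2]%N); (1, [:: 0; 3; 4]%N); (1, [:: 0; 5; 6]%N);
      (1, [:: 1; 3; 5]%N); (-1, [:: 1; 4; 6]%N); (-1, [:: 2; 3; 6]%N);
      (-1, [:: 2; 4; 5]%N)].

(** The value phi0(e_i, e_j, e_k), i.e. the structure constants of the octonion cross product: after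
    three contractions only signed empty lists remain. *)
Definition eps3 (i j k : nat) : int :=
  foldr (fun x c => x.1 + c) 0 (lcontract k (lcontract j (lcontract i phi0_terms))).

Lemma coformE (R : realType) i : @coform R i = lminor R 6 1 [:: i.-1].
Proof.
apply/funext => v; rewrite /coform /lminor /minor.
by rewrite (mx11_scalar (colsub _ _)) det_scalar1 mxE.
Qed.

Lemma coform3E (R : realType) i j k :
  coform3 i j k = lminor R 6 3 [:: i.-1; j.-1; k.-1].
Proof. by rewrite /coform3 !coformE !wedge_lminor. Qed.

Lemma phi0E (R : realType) : @phi0 R = lform R 6 3 phi0_terms.
Proof.
rewrite /phi0 !coform3E /lform !big_cons big_nil /= !scale1r !scaleN1r.
by rewrite addr0 !addrA.
Qed.

(** The big operator is locked, whereas [foldr] reduces under [vm_compute]. *)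
Lemma sum_foldr (T : Type) (f : T -> int) (r : seq T) :
  \sum_(x <- r) f x = foldr (fun x c => f x + c) 0 r.
Proof. by elim: r => [|x r IH]; rewrite ?big_nil ?big_cons ?IH. Qed.

Lemma phi0_contractE (R : realType) (i : 'I_7) :
  @contract R 2 7 (delta_mx 0 i) (@phi0 R) = lform R 6 2 (lcontract i phi0_terms).
Proof.
by rewrite phi0E -contract_lform ?inord_val.
Qed.

Lemma all2_ord n (P : nat -> nat -> bool) :
  all (fun i => all (P i) (iota 0 n)) (iota 0 n) -> forall i j : 'I_n, P i j.
Proof.
move=> /allP Pn i j; have io (k : 'I_n) : val k \in iota 0 n.
  by rewrite mem_iota ltn_ord.
exact: (allP (Pn _ (io i))) _ (io j).
Qed.

Definition rows3 (R : realType) n (x y z : 'rV[R]_n) : 'M[R]_(3, n) :=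
  col_mx x (col_mx y z).

Lemma phi0_coefE (R : realType) (i j k : 'I_7) :
  phi0 (rows3 (delta_mx 0 i) (delta_mx 0 j) (delta_mx 0 k)) =
  (eps3 i j k)%:~R :> R.
Proof.
pose sizes p q :=
  all (fun x => (size x.2 == 2) && all (gtn 7) x.2) (lcontract p phi0_terms) &&
  all (fun x => (size x.2 == 1) && all (gtn 7) x.2)
      (lcontract q (lcontract p phi0_terms)).
have /(_ i j) := @all2_ord 7 sizes ltac:(by vm_compute).
case/andP=> s1 s2.
transitivity (@contract R 0 7 (delta_mx 0 k) (@contract R 1 7 (delta_mx 0 j)
   (@contract R 2 7 (delta_mx 0 i) (@phi0 R))) (0 : 'M[R]_(0, 7))).
  have kE : delta_mx 0 k = col_mx (delta_mx 0 k) 0 :> 'M[R]_(1 + 0, 7).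
    apply/matrixP => a b; rewrite [a]ord1.
    transitivity (col_mx (delta_mx 0 k) (0 : 'M[R]_(0, 7)) (@lshift 1 0 0) b).
      by rewrite col_mxEu.
    by congr (col_mx _ _ _ _); apply/val_inj.
  by rewrite {1}kE.
rewrite phi0_contractE -[j in LHS]inord_val contract_lform //.
rewrite -[k in LHS]inord_val contract_lform // lform0E /eps3.
by rewrite sum_foldr.
Qed.

(** The model case: [phi0] induces the standard metric and volume, with 6 the constant of the
    defining identity. All 49 pairs (i, j) are checked on lists. *)
Lemma phi0_metricE (R : realType) (i j : 'I_7) W :
  wedge (wedge (@contract R 2 7 (delta_mx 0 i) (@phi0 R))
               (@contract R 2 7 (delta_mx 0 j) (@phi0 R))) (@phi0 R) W =
  6%:R * (i == j)%:R * \det W.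
Proof.
pose L p q := lwedge (lcontract p phi0_terms) (lcontract q phi0_terms).
pose checks p q :=
  [&& all (fun x => size x.2 == 2) (lcontract p phi0_terms),
    all (fun x => size x.2 == 4) (L p q),
    all (fun x => (size x.2 == 7) && all (gtn 7) x.2) (lwedge (L p q) phi0_terms) &
    foldr (fun x c => x.1 * levi 7 x.2 + c) 0 (lwedge (L p q) phi0_terms)
      == 6 * (p == q)%N%:R].
have /(_ i j) := @all2_ord 7 checks ltac:(by vm_compute).
case/and4P=> s1 s2 s3 /eqP E.
rewrite !phi0_contractE phi0E !wedge_lform // lform_detE //.
rewrite sum_foldr E intrM -val_eqE; case: (_ == _) => //.
Qed.

(** Naturality of the wedge under the pullback W -> W P, which carries the model computation for
    [phi0] to any positive form. *)
Lemma wedge_comp (R : realType) m n k l (w : kform R k n) (h : kform R l n)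
    (P : 'M[R]_(m, n)) :
  wedge ((fun W => w (W *m P)) : kform R k m) ((fun W => h (W *m P)) : kform R l m)
  = fun W => wedge w h (W *m P).
Proof.
apply/funext => W; rewrite /wedge; congr (_ * _); apply: eq_bigr => s _.
have -> : row_perm s (W *m P) = row_perm s W *m P by rewrite !row_permE mulmxA.
by rewrite -{3 4}(vsubmxK (row_perm s W)) mul_col_mx col_mxKu col_mxKd.
Qed.

Lemma contract_comp (R : realType) m n k (w : kform R (1 + k) n)
    (P : 'M[R]_(m, n)) (u : 'rV[R]_m) :
  contract u ((fun W => w (W *m P)) : kform R (1 + k) m) =
  fun W => contract (u *m P) w (W *m P).
Proof. by apply/funext => W; rewrite /contract mul_col_mx. Qed.

(* With E = P^-1 and c = vol(E), the defining identity says that the Gram matrix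
   of E is c^-1 times the identity.  Hence sqrt(c) E is orthonormal, of volume
   c^(9/2), which has to be 1. *)
Lemma induces_frame (R : realType) (w : kform R 3 7) (G : 'M[R]_7) vol :
  positive_form w -> induces w G vol ->
  exists2 P : 'M[R]_7, P \in unitmx &
    [/\ w = (fun W => phi0 (W *m P)), G = P *m P^T &
        forall W, vol W = \det (W *m P)].
Proof.
move=> [P Pu wE] [[_ Gpos] [_ volE] ind]; exists P => //.
pose E := invmx P; pose A := E *m G *m E^T.
have rowP i : row i E *m P = delta_mx 0 i by rewrite -row_mul mulVmx // row1.
have AE i j : A i j = inner G (row i E) (row j E).
  rewrite /inner -row_mul /A mxE [RHS]mxE; apply: eq_bigr => k _.
  by congr (_ * _); rewrite !mxE.
have Avol i j W : A i j * vol W = (i == j)%:R * \det (W *m P).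
  rewrite AE -[LHS]/((inner G (row i E) (row j E) *: vol) W) ind formZE wE.
  have cE k : @contract R 2 7 (row k E) (fun W => phi0 (W *m P)) =
      fun W => @contract R 2 7 (delta_mx 0 k) (@phi0 R) (W *m P).
    by rewrite -rowP; exact: contract_comp.
  rewrite !cE !wedge_comp phi0_metricE -mulrA mulKf //.
(* Positivity of the metric fixes the orientation: it makes vol(E) positive, so the square root d
   below is usable. *)
have A00 : 0 < A 0 0.
  rewrite AE Gpos //; apply/eqP => /(congr1 (mulmx^~ P)).
  rewrite rowP mul0mx => /matrixP/(_ 0 0)/eqP; rewrite !mxE !eqxx.
  by rewrite oner_eq0.
have EP : E *m P = 1%:M by exact: mulVmx.
have AcE i j : A i j * vol E = (i == j)%:R by rewrite Avol EP det1 mulr1.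
pose d := Num.sqrt (vol E).
have c0 : 0 < vol E by rewrite -(pmulr_rgt0 _ A00) AcE ltr01.
have d0 : 0 < d by rewrite sqrtr_gt0.
have dd : d * d = vol E by rewrite -expr2 sqr_sqrtr // ltW.
have dE : (d *: E) *m G *m (d *: E)^T = 1%:M.
  rewrite linearZ /= -scalemxAr -!scalemxAl scalerA dd.
  by apply/matrixP => i j; rewrite mxE mulrC AcE mxE.
have := volE _ dE; have := Avol 0 0 (d *: E).
rewrite eqxx mul1r -scalemxAl EP scalemx1 det_scalar => volD.
(* Seven factors d come from the determinant of d I_7, two from dividing by A 0 0, whose inverse is
   vol(E) = d^2. *)
have {}volD : vol (d *: E) = d ^+ 9.
  apply: (mulfI (lt0r_neq0 A00)); rewrite volD.
  by rewrite (exprD d 2 7) mulrA expr2 dd AcE mul1r.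
rewrite volD ger0_norm ?exprn_ge0 ?(ltW d0) // => /eqP.
rewrite pexpr_eq1 ?(ltW d0) // => /eqP d1.
have cE1 : vol E = 1 by rewrite -dd d1 mulr1.
have A1 : A = 1%:M by apply/matrixP => i j; rewrite [RHS]mxE -AcE cE1 mulr1.
split=> // [|W].
  have -> : G = P *m A *m P^T; last by rewrite A1 mulmx1.
  rewrite /A !mulmxA mulmxV // mul1mx -mulmxA -trmx_mul mulmxV //.
  by rewrite trmx1 mulmx1.
by have := Avol 0 0 W; rewrite A1 mxE eqxx !mul1r.
Qed.

(** * The polynomial identities *)

Definition triples : seq (seq nat) :=
  flatten [seq flatten [seq [seq [:: p; q; r] | p <- iota 0 q] | q <- iota 0 r]
          | r <- iota 0 7].

(* The operations are parameters so that the formulas can be read both in a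
   commutative ring and in a type of computable polynomials. *)
Section Formulas.
Variables (T : Type) (add mul : T -> T -> T) (opp : T -> T) (cst : int -> T).
Implicit Types (u v : nat -> T) (t : nat -> nat -> nat -> T).

Definition gsum (f : nat -> T) : T :=
  foldr (fun i => add (f i)) (cst 0) (iota 0 7).

Definition gdot u v : T := gsum (fun i => mul (u i) (v i)).

(** Component m i j k of the Hodge star in an oriented orthonormal frame. Summing over increasing
    triples absorbs the factor 1/3!, and skipping zero signs keeps the polynomials small. *)
Definition gstar t (m i j k : nat) : T :=
  foldr (fun p acc =>
    let c := levi 7 (p ++ [:: m; i; j; k]) in
    if c == 0 then acc else
    add (mul (cst c) (t (nth 0 p 0) (nth 0 p 1) (nth 0 p 2))%N) acc)
  (cst 0) triples.

(** Only the numerator of sigma: the factor 1/|A|^2 is left out so that the formula is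
    polynomial. *)
Definition gsigma (a : T) u t (i j k : nat) : T :=
  add (add (mul (add (mul a a) (opp (gdot u u))) (t i j k))
    (opp (mul (mul (cst 2) a) (gsum (fun m => mul (u m) (gstar t m i j k))))))
    (mul (cst 2) (gsum (fun m => mul (u m)
       (add (add (mul (u i) (t m j k)) (opp (mul (u j) (t m i k))))
            (mul (u k) (t m i j)))))).

Definition gphi (i j k : nat) : T := cst (eps3 i j k).

Definition gre (a : T) u (b : T) v : T := add (mul a b) (opp (gdot u v)).

(** Imaginary part of the octonion product in an adapted frame; the double sum is the cross
    product. *)
Definition gim (a : T) u (b : T) v (k : nat) : T :=
  add (add (mul a (v k)) (mul b (u k)))
    (gsum (fun i => gsum (fun j => mul (mul (u i) (v j)) (gphi i j k)))).

Definition gnorm (a : T) u : T := add (mul a a) (gdot u u).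
End Formulas.

Section FormulasMorphism.
Variables (T : Type) (add mul : T -> T -> T) (opp : T -> T) (cst : int -> T).
Variables (T' : Type) (add' mul' : T' -> T' -> T') (opp' : T' -> T') (cst' : int -> T').
Variable ev : T -> T'.
Hypothesis evD : forall x y, ev (add x y) = add' (ev x) (ev y).
Hypothesis evM : forall x y, ev (mul x y) = mul' (ev x) (ev y).
Hypothesis evN : forall x, ev (opp x) = opp' (ev x).
Hypothesis evC : forall z, ev (cst z) = cst' z.

(** Agreement is asked for indices below 7 only, since a polynomial variable evaluates to the right
    coordinate only in that range. *)
Lemma ev_gsum f f' : (forall i, (i < 7)%N -> ev (f i) = f' i) ->
  ev (gsum add cst f) = gsum add' cst' f'.
Proof. by move=> ff'; rewrite /gsum /= !evD evC !ff'. Qed.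

Lemma ev_gstar t t' m i j k :
  (forall p q r, (p < 7)%N -> (q < 7)%N -> (r < 7)%N -> ev (t p q r) = t' p q r) ->
  ev (gstar add mul cst t m i j k) = gstar add' mul' cst' t' m i j k.
Proof.
move=> tt'; rewrite /gstar.
have : all (all (gtn 7)) triples by [].
have : all (fun s => size s == 3) triples by [].
elim: triples => [_ _|s r IH] /=; first exact: evC.
case/andP=> /eqP s3 r3 /andP[s7 r7].
have sl n : (n < 3)%N -> (nth 0%N s n < 7)%N.
  by move=> n3; apply/(allP s7)/mem_nth; rewrite s3.
by case: ifP => _; rewrite ?evD ?evM ?evC ?tt' ?IH ?sl.
Qed.

Lemma ev_gdot u u' v v' :
  (forall i, (i < 7)%N -> ev (u i) = u' i) ->
  (forall i, (i < 7)%N -> ev (v i) = v' i) ->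
  ev (gdot add mul cst u v) = gdot add' mul' cst' u' v'.
Proof. by move=> uu' vv'; apply: ev_gsum => i i7; rewrite evM uu' ?vv'. Qed.

Lemma ev_gre a a' u u' b b' v v' :
  ev a = a' -> ev b = b' ->
  (forall i, (i < 7)%N -> ev (u i) = u' i) ->
  (forall i, (i < 7)%N -> ev (v i) = v' i) ->
  ev (gre add mul opp cst a u b v) = gre add' mul' opp' cst' a' u' b' v'.
Proof.
by move=> aa' bb' uu' vv'; rewrite /gre evD evM evN (ev_gdot uu' vv') aa' bb'.
Qed.

Lemma ev_gim a a' u u' b b' v v' k :
  ev a = a' -> ev b = b' ->
  (forall i, (i < 7)%N -> ev (u i) = u' i) ->
  (forall i, (i < 7)%N -> ev (v i) = v' i) -> (k < 7)%N ->
  ev (gim add mul cst a u b v k) = gim add' mul' cst' a' u' b' v' k.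
Proof.
move=> aa' bb' uu' vv' k7.
rewrite /gim 2!evD 2!evM aa' bb' uu' // vv' //; congr add'.
by do 2![apply: ev_gsum => ? ?]; rewrite !evM evC uu' ?vv'.
Qed.

Lemma ev_gsigma a a' u u' t t' i j k :
  ev a = a' -> (forall i, (i < 7)%N -> ev (u i) = u' i) ->
  (forall p q r, (p < 7)%N -> (q < 7)%N -> (r < 7)%N -> ev (t p q r) = t' p q r) ->
  (i < 7)%N -> (j < 7)%N -> (k < 7)%N ->
  ev (gsigma add mul opp cst a u t i j k) =
  gsigma add' mul' opp' cst' a' u' t' i j k.
Proof.
move=> aa' uu' tt' i7 j7 k7; rewrite /gsigma.
rewrite evD evD evN 4!evM evD evM evN evC aa' tt' // (ev_gdot uu' uu').
congr (add' (add' _ (opp' (mul' _ _))) (mul' _ _)).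
  by apply: ev_gsum => m m7; rewrite evM uu' //; congr mul'; apply: ev_gstar.
apply: ev_gsum => m m7.
by rewrite evM evD evD evN 3!evM !uu' // !tt'.
Qed.

Lemma ev_gnorm a a' u u' :
  ev a = a' -> (forall i, (i < 7)%N -> ev (u i) = u' i) ->
  ev (gnorm add mul cst a u) = gnorm add' mul' cst' a' u'.
Proof. by move=> aa' uu'; rewrite /gnorm evD evM aa' (ev_gdot uu' uu'). Qed.

End FormulasMorphism.

(** * Computable integer polynomials and the soundness of their evaluation *)

Module RP := Ring_polynom.

Definition int_eqb (x y : int) : bool := x == y.
Definition Padd := RP.Padd (0 : int) +%R int_eqb.
Definition Pmul := RP.Pmul (0 : int) 1 +%R *%R int_eqb.
Definition Popp := RP.Popp (-%R : int -> int).
(** Variables of [Pol] are numbered by positive integers, hence the successor: variable 0 is the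
    head of the environment. *)
Definition Pvar (n : nat) : RP.Pol int :=
  RP.mk_X (0 : int) 1 (BinPos.Pos.of_succ_nat n).
Definition Peval (R : comRingType) (l : seq R) : RP.Pol int -> R :=
  RP.Pphi 0 +%R *%R intr l.

Section Reflection.
Variable R : comRingType.

Lemma comRing_eq_ext : Ring_theory.ring_eq_ext +%R *%R (-%R : R -> R) eq.
Proof. by split=> [? ? -> ? ? ->|? ? -> ? ? ->|? ? ->]. Qed.

Lemma comRing_almost_ring :
  Ring_theory.almost_ring_theory 0 1 +%R *%R (fun x y => x - y) (-%R : R -> R) eq.
Proof.
apply: (Ring_theory.Rth_ARth _ comRing_eq_ext).
split=> //; [exact: add0r|exact: addrC|exact: addrA|exact: mul1r|exact: mulrC
  |exact: mulrA|exact: mulrDl|exact: subrr].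
Qed.

Lemma intr_morph : Ring_theory.ring_morph 0 1 +%R *%R (fun x y => x - y)
  (-%R : R -> R) eq 0 1 +%R *%R (fun x y => x - y) -%R int_eqb intr.
Proof.
split=> //; [exact: intrD|exact: intrB|exact: intrM|exact: intrN|].
by move=> x y /eqP ->.
Qed.

Let eq_equiv := @RelationClasses.eq_equivalence R.

Lemma PevalD l p q : Peval l (Padd p q) = Peval l p + Peval l q :> R.
Proof. exact: (RP.Padd_ok eq_equiv comRing_eq_ext comRing_almost_ring intr_morph). Qed.

Lemma PevalM l p q : Peval l (Pmul p q) = Peval l p * Peval l q :> R.
Proof. exact: (RP.Pmul_ok eq_equiv comRing_eq_ext comRing_almost_ring intr_morph). Qed.

Lemma PevalN l p : Peval l (Popp p) = - Peval l p :> R.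
Proof. exact: (RP.Popp_ok eq_equiv comRing_eq_ext comRing_almost_ring intr_morph). Qed.

Lemma PevalX l n : Peval l (Pvar n) = BinList.nth 0 (BinPos.Pos.of_succ_nat n) l :> R.
Proof.
exact/esym/(RP.mkX_ok eq_equiv comRing_eq_ext comRing_almost_ring intr_morph).
Qed.

Lemma Peval_eq l p q : RP.Peq int_eqb p q = true -> Peval l p = Peval l q :> R.
Proof.
by move=> pq; exact: (RP.Peq_ok eq_equiv comRing_eq_ext intr_morph p q pq l).
Qed.

End Reflection.

Definition Psigma := gsigma Padd Pmul Popp (@RP.Pc int).
Definition Pre := gre Padd Pmul Popp (@RP.Pc int).
Definition Pim := gim Padd Pmul (@RP.Pc int).
Definition Pnorm := gnorm Padd Pmul (@RP.Pc int).
Definition Pphi := gphi (@RP.Pc int).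

(* The polynomial variables are a, u_0, ..., u_6, b, v_0, ..., v_6. *)
Definition Pa := Pvar 0.
Definition Pu i := Pvar i.+1.
Definition Pb := Pvar 8.
Definition Pv i := Pvar (9 + i).
Definition Pab := Pre Pa Pu Pb Pv.
Definition Puv := Pim Pa Pu Pb Pv.

(** Both sides are homogeneous of bidegree (2, 2) in (a, u) and (b, v), so the numerators can agree
    as they stand, with no norm factor to insert. *)
Lemma Psigma_mul_check :
  all (fun p => let i := nth 0%N p 0 in let j := nth 0%N p 1 in
    let k := nth 0%N p 2 in
    RP.Peq int_eqb (Psigma Pa Pu (Psigma Pb Pv Pphi) i j k)
              (Psigma Pab Puv Pphi i j k)) triples.
Proof. by vm_compute. Qed.

(** Degen's eight-square identity. *)
Lemma Pnorm_mul_check :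
  RP.Peq int_eqb (Pnorm Pab Puv) (Pmul (Pnorm Pa Pu) (Pnorm Pb Pv)).
Proof. by vm_compute. Qed.

(** * The polynomial identities evaluated in a commutative ring *)

Section RingFormulas.
Variables (R : comRingType) (a b : R) (u v : nat -> R).

Definition rdot := gdot +%R *%R (intr : int -> R).
Definition rstar := gstar +%R *%R (intr : int -> R).
Definition rsigma := gsigma +%R *%R -%R (intr : int -> R).
Definition rre := gre +%R *%R -%R (intr : int -> R).
Definition rim := gim +%R *%R (intr : int -> R).
Definition rnorm := gnorm +%R *%R (intr : int -> R).
Definition rphi := gphi (intr : int -> R).

Let env : seq R := a :: mkseq u 7 ++ b :: mkseq v 7.
Let ev := Peval env.

Let evD : {morph ev : x y / Padd x y >-> x + y}. Proof. exact: PevalD. Qed.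
Let evM : {morph ev : x y / Pmul x y >-> x * y}. Proof. exact: PevalM. Qed.
Let evN : {morph ev : x / Popp x >-> - x}. Proof. exact: PevalN. Qed.
Let evC z : ev (RP.Pc z) = z%:~R. Proof. by []. Qed.
Let eva : ev Pa = a. Proof. exact: PevalX. Qed.
Let evb : ev Pb = b. Proof. exact: PevalX. Qed.
Let evu i : (i < 7)%N -> ev (Pu i) = u i.
Proof. by move=> i7; rewrite [ev _]PevalX; do 7?[case: i i7 => [|i] i7 //]. Qed.
Let evv i : (i < 7)%N -> ev (Pv i) = v i.
Proof. by move=> i7; rewrite [ev _]PevalX; do 7?[case: i i7 => [|i] i7 //]. Qed.
Let evab : ev Pab = rre a u b v.
Proof. exact: (ev_gre evD evM evN evC). Qed.
Let evuv i : (i < 7)%N -> ev (Puv i) = rim a u b v i.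
Proof. exact: (ev_gim evD evM evC). Qed.

Lemma rsigma_mul i j k : (i < j)%N -> (j < k)%N -> (k < 7)%N ->
  rsigma a u (rsigma b v rphi) i j k =
  rsigma (rre a u b v) (rim a u b v) rphi i j k.
Proof.
move=> ij jk k7; have [j7 i7] : (j < 7)%N /\ (i < 7)%N by lia.
have ijk : [:: i; j; k] \in triples.
  apply/flattenP; eexists; first by apply/mapP; exists k; rewrite ?mem_iota.
  apply/flattenP; eexists; first by apply/mapP; exists j; rewrite ?mem_iota.
  by apply/mapP; exists i; rewrite ?mem_iota.
have /Peval_eq E := allP Psigma_mul_check _ ijk; have := E R env.
have evphi p q r : (p < 7)%N -> (q < 7)%N -> (r < 7)%N ->
  ev (Pphi p q r) = rphi p q r by [].
rewrite [LHS](ev_gsigma evD evM evN evC (a' := a) (u' := u) (t' := rsigma b v rphi)) //.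
  by move=> E2; apply: etrans E2 _; apply: (ev_gsigma evD evM evN evC).
by move=> p q r p7 q7 r7; apply: (ev_gsigma evD evM evN evC).
Qed.

Lemma rnorm_mul : rnorm (rre a u b v) (rim a u b v) = rnorm a u * rnorm b v.
Proof.
apply: etrans (esym (ev_gnorm evD evM evC evab evuv)) _.
rewrite [LHS](Peval_eq env Pnorm_mul_check) PevalM; congr (_ * _).
  exact: (ev_gnorm evD evM evC eva evu).
exact: (ev_gnorm evD evM evC evb evv).
Qed.

(** Homogeneity in the 3-form lets the factor 1/|V|^2 of the inner sigma pass through the outer
    one. *)
Lemma rsigmaZ c t i j k :
  rsigma a u (fun p q r => c * t p q r) i j k = c * rsigma a u t i j k.
Proof.
have starZ m : rstar (fun p q r => c * t p q r) m i j k = c * rstar t m i j k.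
  rewrite /rstar /gstar; elim: triples => [|p r IH] /=; first by rewrite mulr0.
  by case: ifP => _; rewrite // IH mulrDr mulrCA.
have sumZ f f' : (forall m, f' m = c * f m) -> gsum +%R intr f' = c * gsum +%R intr f.
  move=> ff'; rewrite /gsum; elim: (iota 0 7) => [|m r IH] /=.
    by rewrite mulr0.
  by rewrite ff' IH mulrDr.
pose F t m := u m * rstar t m i j k.
pose H (t : nat -> nat -> nat -> R) m :=
  u m * (u i * t m j k - u j * t m i k + u k * t m i j).
have sigmaE t0 : rsigma a u t0 i j k =
    (a * a - rdot u u) * t0 i j k - 2%:~R * a * gsum +%R intr (F t0)
    + 2%:~R * gsum +%R intr (H t0) by [].
pose ct p q r := c * t p q r.
have FZ : gsum +%R intr (F ct) = c * gsum +%R intr (F t).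
  by apply: sumZ => m; rewrite /F starZ mulrCA.
have HZ : gsum +%R intr (H ct) = c * gsum +%R intr (H t).
  apply: sumZ => m; rewrite /H /ct.
  by move: (t m j k) (t m i k) (t m i j) => x y z; ring.
have comb d t0 t1 x x' y y' : t1 = c * t0 -> x' = c * x -> y' = c * y ->
    d * t1 - 2%:~R * a * x' + 2%:~R * y' = c * (d * t0 - 2%:~R * a * x + 2%:~R * y).
  by move=> -> -> ->; ring.
by rewrite -/ct (sigmaE ct) (sigmaE t); exact: (comb _ _ _ _ _ _ _ (erefl _) FZ HZ).
Qed.

End RingFormulas.

(** * Components in an orthonormal frame *)

Section SymmetricSums.
Variable R : comRingType.

Lemma sum_sym2 n (g : nat -> nat -> R) :
  (forall p q, g p q = g q p) -> (forall p, g p p = 0) ->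
  \sum_(0 <= p < n) \sum_(0 <= q < n) g p q =
  2%:R * \sum_(0 <= q < n) \sum_(0 <= p < q) g p q.
Proof.
move=> gC g0; elim: n => [|n IH]; first by rewrite !big_geq // mulr0.
rewrite big_nat_recr //= (big_nat_recr n) //= [in RHS]big_nat_recr //= mulrDr -IH.
under eq_bigr => p _ do rewrite big_nat_recr //=.
rewrite big_split /= g0 addr0 -addrA; congr (_ + _).
rewrite [X in _ + X](eq_bigr (fun p => g p n)); last by move=> p _; rewrite gC.
by rewrite mulr_natl mulr2n.
Qed.

(** Each increasing triple is counted once per ordering, 3! times in all, and triples with a
    repetition vanish. It removes the redundancy of the index formula for the Hodge star. *)
Lemma sum_sym3 n (F : nat -> nat -> nat -> R) :
  (forall p q r, F p q r = F q p r) -> (forall p q r, F p q r = F p r q) ->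
  (forall p q, F p p q = 0) ->
  \sum_(0 <= p < n) \sum_(0 <= q < n) \sum_(0 <= r < n) F p q r =
  6%:R * \sum_(0 <= r < n) \sum_(0 <= q < r) \sum_(0 <= p < q) F p q r.
Proof.
move=> F12 F23 F0; elim: n => [|n IH]; first by rewrite !big_geq // mulr0.
have F0' p q : F p q q = 0 by rewrite F12 F23.
rewrite [in RHS]big_nat_recr //= mulrDr -IH.
have F0n := fun r => F0 r n.
(* In passing from n to n.+1, the new index n can occupy three positions, each contributing the full
   double sum [S] defined next. *)
have -> : 6%:R * \sum_(0 <= q < n) \sum_(0 <= p < q) F p q n =
    3%:R * \sum_(0 <= p < n) \sum_(0 <= q < n) F p q n.
  by rewrite sum_sym2 // mulrA -natrM.
pose S := \sum_(0 <= p < n) \sum_(0 <= q < n) F p q n.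
have inner p q : \sum_(0 <= r < n.+1) F p q r = \sum_(0 <= r < n) F p q r + F p q n.
  by rewrite big_nat_recr.
have mid p : \sum_(0 <= q < n.+1) \sum_(0 <= r < n.+1) F p q r =
    \sum_(0 <= q < n) \sum_(0 <= r < n) F p q r + \sum_(0 <= q < n) F p q n
    + \sum_(0 <= q < n) F p q n.
  rewrite big_nat_recr //= inner F0' addr0.
  under eq_bigr => q _ do rewrite inner.
  by rewrite big_split /=; congr (_ + _); apply: eq_bigr => q _; rewrite F23.
rewrite big_nat_recr //= mid.
under eq_bigr => p _ do rewrite mid.
rewrite !big_split /= -!/S.
have -> : \sum_(0 <= q < n) F n q n = 0.
  by rewrite big1 // => q _; rewrite F23 F0.
have -> : \sum_(0 <= q < n) \sum_(0 <= r < n) F n q r = S.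
  by apply: eq_bigr => q _; apply: eq_bigr => r _; rewrite F12 F23.
by ring.
Qed.
End SymmetricSums.

Lemma rows3E (R : realType) n (x y z : 'rV[R]_n) i a :
  rows3 x y z i a = nth x [:: x; y; z] i 0 a.
Proof.
rewrite /rows3; case: (@split_ordP 1 2 i) => b ->.
  by rewrite [LHS](@col_mxEu _ 1 2) ord1.
rewrite [LHS](@col_mxEd _ 1 2); case: (@split_ordP 1 1 b) => c ->.
  by rewrite [LHS](@col_mxEu _ 1 1) ord1.
by rewrite [LHS](@col_mxEd _ 1 1) ord1.
Qed.

Lemma ord3P (i : 'I_3) : [\/ i = 0, i = 1 | i = 2].
Proof.
by case: i => -[|[|[|//]]] i3; [apply: Or31|apply: Or32|apply: Or33]; apply/val_inj.
Qed.

Lemma form_rows3_swap (R : realType) n (w : kform R 3 n) x y z : is_form w ->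
  [/\ w (rows3 y x z) = - w (rows3 x y z),
      w (rows3 x z y) = - w (rows3 x y z) & w (rows3 x x z) = 0].
Proof.
move=> wf; split.
- rewrite -(@form_xrow _ _ _ w 0 1) //; congr w; apply/matrixP => i a.
  rewrite [RHS]mxE !rows3E; case: (ord3P i) => ->.
  + by rewrite tpermL.
  + by rewrite tpermR.
  by rewrite tpermD.
- rewrite -(@form_xrow _ _ _ w 1 2) //; congr w; apply/matrixP => i a.
  rewrite [RHS]mxE !rows3E; case: (ord3P i) => ->.
  + by rewrite tpermD.
  + by rewrite tpermL.
  by rewrite tpermR.
case: wf => _ /(_ 0 1); apply => //.
by apply/rowP => a; rewrite mxE [RHS]mxE !rows3E.
Qed.

Lemma rowsub_ordS (R : realType) m n k (E : 'M[R]_(m, n)) (j : 'I_m)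
    (f : {ffun 'I_k -> 'I_m}) :
  rowsub [ffun i : 'I_(1 + k) =>
    match fintype.split i with inl _ => j | inr i' => f i' end] E =
  col_mx (row j E) (rowsub f E).
Proof.
apply/matrixP => i a; rewrite !mxE ffunE.
by case: (fintype.split i) => b; rewrite !mxE.
Qed.

Lemma big_ffun_ord3 (R : realType) m n (E : 'M[R]_(m, n)) (F : 'M[R]_(3, n) -> R) :
  \sum_(f : {ffun 'I_3 -> 'I_m}) F (rowsub f E) =
  \sum_p \sum_q \sum_r F (rows3 (row p E) (row q E) (row r E)).
Proof.
rewrite [LHS](@big_ffun_ordS _ _ 2); apply: eq_bigr => p _.
rewrite (@big_ffun_ordS _ _ 1); apply: eq_bigr => q _.
rewrite (@big_ffun_ordS _ _ 0); apply: eq_bigr => r _.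
pose f0 := [ffun i : 'I_0 => r].
rewrite (big_ffun_ord0 _ f0); congr F.
rewrite [LHS](@rowsub_ordS _ _ _ 2); congr (@col_mx _ 1 2 _ _ _).
rewrite [LHS](@rowsub_ordS _ _ _ 1); congr (@col_mx _ 1 1 _ _ _).
rewrite [LHS](@rowsub_ordS _ _ _ 0); apply/matrixP => i a.
rewrite [i]ord1 -[RHS](col_mxEu _ (rowsub f0 E)).
by congr (col_mx _ _ _ _); apply/val_inj.
Qed.

(** For E = P^-1, G^-1 = E^T E. Expanding the raised vectors along the rows of E yields coefficients
    which, after exchanging the sums, are exactly those that assemble the rows of E inside [vol]. In
    an orthonormal frame no index needs raising. *)
Lemma hodge_frame (R : realType) k l (P G : 'M[R]_(k + l)) vol w W :
  P \in unitmx -> G = P *m P^T -> is_form vol -> is_form w ->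
  hodge G vol w W = k`!%:R^-1 * \sum_(f : {ffun 'I_k -> 'I_(k + l)})
    w (rowsub f (invmx P)) * vol (col_mx (rowsub f (invmx P)) W).
Proof.
move=> Pu -> vf wf; rewrite /hodge; congr (_ * _); set E := invmx P.
have GE : invmx (P *m P^T) = E^T *m E.
  apply: (can_inj (mulKmx (_ : P *m P^T \in unitmx))).
    by rewrite unitmx_mul unitmx_tr Pu.
  rewrite mulmxV ?unitmx_mul ?unitmx_tr ?Pu // mulmxA -(mulmxA P) -trmx_mul.
  by rewrite mulVmx // trmx1 mulmx1 mulmxV.
have wE (f : {ffun 'I_k -> 'I_(k + l)}) : w (rowsub f (invmx (P *m P^T))) =
    \sum_(g : {ffun 'I_k -> 'I_(k + l)})
      (\prod_i E (g i) (f i)) * w (rowsub g E).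
  rewrite GE -mul_rowsub_mx form_expand //; apply: eq_bigr => g _; congr (_ * _).
  by apply: eq_bigr => i _; rewrite !mxE.
have volE (g : {ffun 'I_k -> 'I_(k + l)}) : vol (col_mx (rowsub g E) W) =
    \sum_(f : {ffun 'I_k -> 'I_(k + l)})
      (\prod_i E (g i) (f i)) * vol (col_mx (rowsub f 1%:M) W).
  rewrite -[rowsub g E]mulmx1 [LHS](form_expand _ _ (is_form_col_mxl W vf)).
  apply: eq_bigr => f _; congr (_ * _).
  by apply: eq_bigr => i _; rewrite !mxE.
under eq_bigr => f _ do rewrite wE mulr_suml.
rewrite exchange_big; apply: eq_bigr => g _.
rewrite volE mulr_sumr; apply: eq_bigr => f _.
by rewrite mulrAC mulrC.
Qed.

(** Entries have the shape expected by [det_levi], so the volume of a list of frame vectors becomes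
    a value of [levi]. *)
Definition unit_rows (R : realType) k n (s : seq nat) : 'M[R]_(k, n) :=
  \matrix_(i, j) (nth 0%N s i == j)%N%:R.

Lemma col_mx_unit_rows (R : realType) k l n s t : size s = k ->
  col_mx (@unit_rows R k n s) (@unit_rows R l n t) = @unit_rows R (k + l) n (s ++ t).
Proof.
move=> sk; apply/matrixP => i j; rewrite [RHS]mxE nth_cat sk.
by case: (split_ordP i) => a ->; rewrite ?col_mxEu ?col_mxEd mxE /= ?addKn.
Qed.

Lemma is_formN (R : realType) k n (w : kform R k n) : is_form w -> is_form (- w).
Proof. by rewrite -scaleN1r; exact: is_formZ. Qed.

Lemma is_form_hodge (R : realType) k l (G : 'M[R]_(k + l)) vol w :
  is_form vol -> is_form (@hodge R k l G vol w).
Proof.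
move=> volf; apply: is_formZ.
have -> : (fun W => \sum_(f : {ffun 'I_k -> 'I_(k + l)})
      w (rowsub f (invmx G)) * vol (col_mx (rowsub f 1%:M) W)) =
    \sum_(f : {ffun 'I_k -> 'I_(k + l)}) (w (rowsub f (invmx G)) : R) *:
      ((fun W => vol (col_mx (rowsub f 1%:M) W)) : kform R l (k + l)).
  by apply/funext => W; rewrite form_sumE.
by apply: is_form_sum => f; apply: is_formZ; exact: is_form_col_mxr.
Qed.

Section Frame.
Variables (R : realType) (P G : 'M[R]_7) (vol : kform R 7 7).
Hypotheses (Pu : P \in unitmx) (GE : G = P *m P^T).
Hypothesis Gip : inner_product G.
Hypotheses (volf : is_form vol) (volE : forall W, vol W = \det (W *m P)).

Definition frame (i : nat) : 'rV[R]_7 := row (inord i) (invmx P).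

Definition coord (u : 'rV[R]_7) (i : nat) : R := (u *m P) 0 (inord i).

Definition coef (w : kform R 3 7) (i j k : nat) : R :=
  w (rows3 (frame i) (frame j) (frame k)).

Lemma big_gsum (f : nat -> R) : \sum_(i < 7) f i = gsum +%R intr f.
Proof. by rewrite -(big_mkord xpredT) /index_iota unlock. Qed.

Lemma coordE u : u = \sum_(i < 7) coord u i *: frame i.
Proof.
rewrite -{1}[u](mulmxK Pu) mulmx_sum_row; apply: eq_bigr => i _.
by rewrite /coord /frame inord_val.
Qed.

Lemma innerE u v : inner G u v = rdot (coord u) (coord v).
Proof.
rewrite /inner GE mulmxA -mulmxA -trmx_mul mxE /rdot /gdot -big_gsum.
apply: eq_bigr => i _.
by rewrite [X in _ * X]mxE /coord inord_val.
Qed.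

Lemma frame_mul i : frame i *m P = delta_mx 0 (inord i).
Proof. by rewrite /frame -row_mul mulVmx // row1. Qed.

Lemma coord_frame i j : (i < 7)%N -> (j < 7)%N -> coord (frame i) j = (i == j)%:R.
Proof.
move=> i7 j7; rewrite /coord frame_mul mxE eqxx -val_eqE /= !inordK //.
by rewrite eq_sym.
Qed.

Lemma frame_unit_rows i : (i < 7)%N -> frame i *m P = unit_rows R 1 7 [:: i].
Proof.
move=> i7; rewrite frame_mul; apply/rowP => j; rewrite !mxE eqxx /=.
by rewrite -val_eqE /= inordK // eq_sym.
Qed.

Lemma rows3_unit_rows i j k : (i < 7)%N -> (j < 7)%N -> (k < 7)%N ->
  rows3 (frame i) (frame j) (frame k) *m P = unit_rows R 3 7 [:: i; j; k].
Proof.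
move=> i7 j7 k7; rewrite [LHS](@mul_col_mx _ 1 2) (@mul_col_mx _ 1 1).
rewrite !frame_unit_rows //.
by rewrite (@col_mx_unit_rows _ 1 1) // (@col_mx_unit_rows _ 1 2).
Qed.

Lemma inner_frame u i : (i < 7)%N -> inner G u (frame i) = coord u i.
Proof.
move=> i7; rewrite innerE /rdot /gdot -big_gsum (bigD1 (Ordinal i7)) //= big1.
  by rewrite coord_frame // eqxx mulr1 addr0.
by move=> j; rewrite -val_eqE /= => ji; rewrite coord_frame // eq_sym (negPf ji) mulr0.
Qed.

Lemma form_coordE k (w : kform R (1 + k) 7) u W : is_form w ->
  w (col_mx u W) = gsum +%R intr (fun m => coord u m * w (col_mx (frame m) W)).
Proof. by move=> wf; rewrite {1}(coordE u) form_slot_sum // -big_gsum. Qed.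

(** The summand is a product of two alternating expressions, hence symmetric and zero on repeated
    indices, so [sum_sym3] applies. *)
Lemma hodge_coef (w : kform R 3 7) m i j k : is_form w ->
  (m < 7)%N -> (i < 7)%N -> (j < 7)%N -> (k < 7)%N ->
  @hodge R 3 4 G vol w (col_mx (frame m) (rows3 (frame i) (frame j) (frame k))) =
  rstar (coef w) m i j k.
Proof.
move=> wf m7 i7 j7 k7; rewrite (@hodge_frame R 3 4 P) //.
set W : 'M[R]_(4, 7) := @col_mx R 1 3 7 _ _; pose h X := vol (@col_mx R 3 4 7 X W).
have hf : is_form (h : kform R 3 7) by exact: is_form_col_mxl.
rewrite [X in _ * X](big_ffun_ord3 (invmx P) (fun X => w X * h X)).
pose F p q r := coef w p q r * coef h p q r.
have FE (p q r : 'I_7) : w (rows3 (row p (invmx P)) (row q (invmx P)) (row r (invmx P)))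
    * h (rows3 (row p (invmx P)) (row q (invmx P)) (row r (invmx P))) = F p q r.
  by rewrite /F /coef /frame !inord_val.
under eq_bigr => p _ do under eq_bigr => q _ do under eq_bigr => r _ do rewrite FE.
have hE p q r : (p < 7)%N -> (q < 7)%N -> (r < 7)%N ->
    coef h p q r = (levi 7 [:: p; q; r; m; i; j; k])%:~R.
  move=> p7 q7 r7; rewrite /coef /h volE [_ *m P](@mul_col_mx _ 3 4) rows3_unit_rows //.
  rewrite [W *m P](@mul_col_mx _ 1 3) rows3_unit_rows // frame_unit_rows //.
  rewrite (@col_mx_unit_rows _ 1 3) // (@col_mx_unit_rows _ 3 4) // det_levi //.
  by rewrite /= p7 q7 r7 m7 i7 j7 k7.
have -> : \sum_(p < 7) \sum_(q < 7) \sum_(r < 7) F p q r =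
    \sum_(0 <= p < 7) \sum_(0 <= q < 7) \sum_(0 <= r < 7) F p q r.
  rewrite big_mkord; apply: eq_bigr => p _; rewrite big_mkord.
  by apply: eq_bigr => q _; rewrite big_mkord.
rewrite sum_sym3 => [|p q r|p q r|p q]; first last.
- rewrite /F /coef; have [_ _ ->] := form_rows3_swap (frame p) 0 (frame q) wf.
  by rewrite mul0r.
- rewrite /F /coef.
  have [_ -> _] := form_rows3_swap (frame p) (frame r) (frame q) wf.
  by have [_ -> _] := form_rows3_swap (frame p) (frame r) (frame q) hf; rewrite mulrNN.
- rewrite /F /coef.
  have [-> _ _] := form_rows3_swap (frame q) (frame p) (frame r) wf.
  by have [-> _ _] := form_rows3_swap (frame q) (frame p) (frame r) hf; rewrite mulrNN.
have six : 6%:R != 0 :> R by rewrite pnatr_eq0.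
(* The 3! of the Hodge normalization cancels the 6 produced by [sum_sym3]. *)
rewrite [X in X%:R^-1](_ : _ = 6%N) // mulKf //.
transitivity (\sum_(s <- triples) coef w (nth 0%N s 0) (nth 0%N s 1) (nth 0%N s 2) *
    (levi 7 (s ++ [:: m; i; j; k]))%:~R : R).
  rewrite /triples big_flatten big_map; apply: eq_big_seq => r.
  rewrite mem_index_iota => /= r7; rewrite big_flatten big_map /index_iota subn0.
  apply: eq_big_seq => q; rewrite mem_iota => /= qr; rewrite big_map subn0.
  apply: eq_big_seq => p; rewrite mem_iota => /= pq.
  by rewrite /F hE //; lia.
rewrite /rstar /gstar; elim: triples => [|s r IH]; first by rewrite big_nil.
rewrite big_cons IH /=; case: eqP => [->|_]; last by rewrite mulrC.
by rewrite mulr0 add0r.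
Qed.

Lemma form_coord_coef w u j k : is_form w ->
  w (rows3 u (frame j) (frame k)) =
  gsum +%R intr (fun m => coord u m * coef w m j k).
Proof. exact: (@form_coordE 2). Qed.

Lemma hodge_coord_coef (w : kform R 3 7) u i j k : is_form w ->
  (i < 7)%N -> (j < 7)%N -> (k < 7)%N ->
  @contract R 3 7 u (@hodge R 3 4 G vol w) (rows3 (frame i) (frame j) (frame k)) =
  gsum +%R intr (fun m => coord u m * rstar (coef w) m i j k).
Proof.
move=> wf i7 j7 k7; rewrite [LHS](@form_coordE 3) -?big_gsum.
  by apply: eq_bigr => m _; congr (_ * _); exact: hodge_coef.
exact: (@is_form_hodge R 3 4 G vol w volf).
Qed.

Lemma wedge_coef (w : kform R 3 7) u i j k : is_form w ->
  (i < 7)%N -> (j < 7)%N -> (k < 7)%N ->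
  wedge (flat G u) (@contract R 2 7 u w) (rows3 (frame i) (frame j) (frame k)) =
  gsum +%R intr (fun m => coord u m * (coord u i * coef w m j k
     - coord u j * coef w m i k + coord u k * coef w m i j)).
Proof.
move=> wf i7 j7 k7; rewrite [LHS]wedge12E; last exact: is_form_contract.
rewrite /flat !inner_frame // /contract.
rewrite -!/(rows3 _ _ _) !form_coord_coef // -!big_gsum !mulr_sumr -sumrB -big_split.
apply: eq_bigr => m _ /=; move: (coef w _ _ _) (coef w _ _ _) (coef w _ _ _) => x y z.
by ring.
Qed.

Lemma sigma_coef (w : kform R 3 7) a u i j k : is_form w ->
  (i < 7)%N -> (j < 7)%N -> (k < 7)%N ->
  coef (sigma_at G vol (a, u) w) i j k =
  (rnorm a (coord u))^-1 * rsigma a (coord u) (coef w) i j k.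
Proof.
move=> wf i7 j7 k7.
rewrite /coef /sigma_at formZE; congr (_^-1 * _).
  by rewrite /onorm2 innerE expr2.
set W := rows3 _ _ _.
transitivity ((a ^+ 2 - inner G u u) * w W
   - 2 * a * @contract R 3 7 u (@hodge R 3 4 G vol w) W
   + 2 * wedge (flat G u) (@contract R 2 7 u w) W); first by [].
by rewrite hodge_coord_coef // wedge_coef // innerE expr2.
Qed.

Lemma is_form_sigma A w : is_form w -> is_form (sigma_at G vol A w).
Proof.
case: A => a u wf; have hf := @is_form_hodge R 3 4 G vol w volf.
have cf : is_form (@contract R 3 7 u (@hodge R 3 4 G vol w)) by exact: is_form_contract.
have wcf := @is_form_wedge _ _ 1 2 _ _ (is_form_flat G u)
  (@is_form_contract R 2 7 u w wf).
apply: is_formZ; apply: is_formD; last exact: is_formZ.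
by apply: is_formD; [|apply: is_formN]; exact: is_formZ.
Qed.

(** Alternation extends agreement from increasing triples to all triples; writing W as (W P) P^-1
    and expanding then gives agreement everywhere. It matches the range of the computed check. *)
Lemma form_eq_coef (w h : kform R 3 7) : is_form w -> is_form h ->
  (forall i j k, (i < j)%N -> (j < k)%N -> (k < 7)%N -> coef w i j k = coef h i j k) ->
  w = h.
Proof.
move=> wf hf wh.
have {}wh i j k : (i < 7)%N -> (j < 7)%N -> (k < 7)%N -> coef w i j k = coef h i j k.
  have [wh12 wh23] : (forall i j k, coef w i j k = coef h i j k ->
      coef w j i k = coef h j i k) /\
      (forall i j k, coef w i j k = coef h i j k -> coef w i k j = coef h i k j).
    split=> p q r; rewrite /coef => E.
      have [-> _ _] := form_rows3_swap (frame p) (frame q) (frame r) wf.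
      by have [-> _ _] := form_rows3_swap (frame p) (frame q) (frame r) hf; rewrite E.
    have [_ -> _] := form_rows3_swap (frame p) (frame q) (frame r) wf.
    by have [_ -> _] := form_rows3_swap (frame p) (frame q) (frame r) hf; rewrite E.
  have wh0 p q : coef w p p q = coef h p p q.
    rewrite /coef.
    have [_ _ ->] := form_rows3_swap (frame p) 0 (frame q) wf.
    by have [_ _ ->] := form_rows3_swap (frame p) 0 (frame q) hf.
  have whlt p q r : (p < q)%N -> (p < 7)%N -> (q < 7)%N -> (r < 7)%N ->
      coef w p q r = coef h p q r.
    move=> pq p7 q7 r7; case: (ltngtP q r) => [qr|rq|<-]; first exact: wh.
      case: (ltngtP p r) => [pr|rp|<-]; first exact/wh23/wh.
        by apply/wh23/wh12/wh.
      by apply/wh23.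
    by apply/wh12/wh23/wh0.
  move=> i7 j7 k7; case: (ltngtP i j) => [ij|ji|<-]; first exact: whlt.
    by apply/wh12/whlt.
  exact: wh0.
apply/funext => W; rewrite -[W](mulmxK Pu) !form_expand //.
apply: eq_bigr => f _; congr (_ * _).
have -> : rowsub f (invmx P) = rows3 (frame (f 0)) (frame (f 1)) (frame (f 2)).
  apply/matrixP => i a; rewrite mxE rows3E /frame.
  by case: (ord3P i) => ->; rewrite [RHS]mxE inord_val.
exact: wh.
Qed.

End Frame.

(** Extensionality below 7, obtained as transport along the identity map. *)
Lemma rsigma_eq (R : comRingType) (a : R) u u' t t' i j k :
  (forall m, (m < 7)%N -> u m = u' m) ->
  (forall p q r, (p < 7)%N -> (q < 7)%N -> (r < 7)%N -> t p q r = t' p q r) ->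
  (i < 7)%N -> (j < 7)%N -> (k < 7)%N ->
  rsigma a u t i j k = rsigma a u' t' i j k.
Proof. by move=> uu' tt'; apply: (@ev_gsigma _ _ _ _ _ _ _ _ _ _ id). Qed.

Lemma rnorm_eq (R : comRingType) (a : R) u u' :
  (forall m, (m < 7)%N -> u m = u' m) -> rnorm a u = rnorm a u'.
Proof. by move=> uu'; apply: (@ev_gnorm _ _ _ _ _ _ _ _ id). Qed.

(** * The identity at a single point, in a frame adapted to the form *)

Section PositiveFormFrame.
Variables (R : realType) (P G : 'M[R]_7) (vol : kform R 7 7) (w : kform R 3 7).
Hypotheses (Pu : P \in unitmx) (GE : G = P *m P^T).
Hypothesis Gip : inner_product G.
Hypotheses (volf : is_form vol) (volE : forall W, vol W = \det (W *m P)).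
Hypotheses (wf : is_form w) (wE : w = fun W => phi0 (W *m P)).

Lemma coef_phi i j k : (i < 7)%N -> (j < 7)%N -> (k < 7)%N ->
  coef P w i j k = rphi R i j k.
Proof.
move=> i7 j7 k7; rewrite /coef wE.
transitivity (phi0 (rows3 (delta_mx 0 (inord i)) (delta_mx 0 (inord j))
  (delta_mx 0 (inord k) : 'rV[R]_7))); last by rewrite phi0_coefE !inordK.
congr phi0; rewrite [LHS](@mul_col_mx _ 1 2) (@mul_col_mx _ 1 1).
by rewrite !frame_mul.
Qed.

(** Coordinate k of the cross product is its inner product with the k-th frame vector, hence w(u, v,
    e_k), which is expanded in its first two slots. *)
Lemma coord_omul a u b v k : (k < 7)%N ->
  coord P (omul G w (a, u) (b, v)).2 k = rim a (coord P u) b (coord P v) k.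
Proof.
move=> k7; have cD x y : coord P (x + y) k = coord P x k + coord P y k.
  by rewrite /coord mulmxDl mxE.
have cZ c x : coord P (c *: x) k = c * coord P x k.
  by rewrite /coord -scalemxAl mxE.
rewrite /= !cD !cZ; congr (_ + _); rewrite -(inner_frame Pu GE) // crossP //.
rewrite -[LHS]/(w (@col_mx R 1 2 7 u _)) (form_coordE Pu) // -!big_gsum.
apply: eq_bigr => i _.
rewrite -[w _]/(@contract R 2 7 (frame P i) w (@col_mx R 1 1 7 v _)).
rewrite (form_coordE Pu); last exact: is_form_contract.
rewrite -!big_gsum mulr_sumr; apply: eq_bigr => j _.
by rewrite mulrA; congr (_ * _); exact: coef_phi.
Qed.

Lemma sigma_at_omul A B :
  sigma_at G vol A (sigma_at G vol B w) = sigma_at G vol (omul G w A B) w.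
Proof.
case: A B => [a u] [b v]; have sf X h := @is_form_sigma R G vol volf X h.
apply: (form_eq_coef Pu) => [||i j k ij jk k7].
- by apply: (sf); apply: (sf).
- exact: (sf).
have [j7 i7] : (j < 7)%N /\ (i < 7)%N by lia.
rewrite (sigma_coef Pu GE) //; last exact: (sf).
(* The components of the inner sigma, already divided by the squared norm of (b, v). *)
pose t p q r := (rnorm b (coord P v))^-1 * rsigma b (coord P v) (rphi R) p q r.
rewrite (@rsigma_eq _ a _ (coord P u) _ t) // => [|p q r p7 q7 r7]; last first.
  rewrite (sigma_coef Pu GE) //; congr (_ * _).
  by apply: rsigma_eq => // *; exact: coef_phi.
(* With the inner scalar pulled out, the numerators agree by the polynomial identity, and the two
   inverse norms merge into that of the product. *)
rewrite rsigmaZ rsigma_mul // mulrA -invfM -rnorm_mul.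
rewrite [omul _ _ _ _]surjective_pairing (sigma_coef Pu GE) //.
rewrite (_ : (omul _ _ _ _).1 = rre a (coord P u) b (coord P v)); last first.
  by rewrite /= (innerE GE).
congr (_^-1 * _).
  by apply: rnorm_eq => m m7; rewrite coord_omul.
by apply: rsigma_eq => // *; rewrite ?coord_omul ?coef_phi.
Qed.

End PositiveFormFrame.

Theorem theorem4p8 (R : realType) (M : smooth_manifold R 7)
    (phi : M -> kform R 3 7) (g : M -> 'M[R]_7) (vol : M -> kform R 7 7)
    (U V : M -> octonion R) :
  G2_structure phi ->
  associated_metric phi g vol ->
  octonion_section U -> nowhere_vanishing U ->
  octonion_section V -> nowhere_vanishing V ->
  sigma g vol U (sigma g vol V phi) =
  sigma g vol (octonion_mul g phi U V) phi.
Proof.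
move=> [[phif _] phipos] [[gip _] [volf _] ind] _ _ _ _; apply/funext => p.
have [P Pu [phiE gE volE]] := induces_frame (phipos p) (ind p).
exact: (sigma_at_omul Pu gE (gip p) (volf p) volE (phif p) phiE).
Qed.
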